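(* Let $\Omega\subset\mathbb{R}^d$ be an open set of finite measure, and let $\lambda_1(\Omega)<\lambda_2(\Omega)\le\dots$ be the eigenvalues (counted with multiplicity) of the operator $\mathcal H=\frac12\log(-\Delta)$ in $\Omega$ with Dirichlet condition $\varphi=0$ on $\mathbb{R}^d\setminus\Omega$. Then for every $\lambda\in\mathbb{R}$, $$\sum_{k}(\lambda-\lambda_k(\Omega))_+\le \frac{1}{(2\pi)^d}\,|\Omega|\,e^{d\lambda}\,|B_d|\,d^{-1}.$$
   Context: Here $d\ge1$ is an integer, $\Omega$ is nonempty, $|\cdot|$ of a set is Lebesgue measure, $B_d$ is the unit ball in $\mathbb{R}^d$, and $(t)_+=\max\{t,0\}$. The Fourier transform is $\widehat\varphi(\xi)=\int_{\mathbb{R}^d}e^{-ix\cdot\xi}\varphi(x)\,dx$, and $L^2(\Omega)$ is identified with the functions in $L^2(\mathbb{R}^d)$ vanishing on $\mathbb{R}^d\setminus\Omega$. Let $\mathbb{H}(\Omega)\subset L^2(\Omega)$ be the closure (completion) of $C_c^\infty(\Omega)$ with respect to the norm $\|\varphi\|_*$ given by $\|\varphi\|_*^2=\int_{\mathbb{R}^d}\log(e+|\xi|)\,|\widehat\varphi(\xi)|^2\,d\xi$. The quadratic form $$(\varphi,\varphi)_{\log}=\frac{1}{(2\pi)^d}\int_{\mathbb{R}^d}\log(|\xi|)\,|\widehat\varphi(\xi)|^2\,d\xi$$ (with associated sesquilinear form $(\varphi,\psi)_{\log}=\frac{1}{(2\pi)^d}\int_{\mathbb{R}^d}\log(|\xi|)\,\widehat\varphi(\xi)\overline{\widehat\psi(\xi)}\,d\xi$)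 with domain $\mathbb{H}(\Omega)$ is closed, symmetric and semibounded in $L^2(\Omega)$; $\mathcal H$ is the associated self-adjoint operator in $L^2(\Omega)$. Eigenvalues are understood weakly: $\varphi\in\mathbb{H}(\Omega)\setminus\{0\}$ is an eigenfunction with eigenvalue $\lambda$ if $(\varphi,\psi)_{\log}=\lambda\int_\Omega\varphi\overline{\psi}\,dx$ for all $\psi\in\mathbb{H}(\Omega)$. The spectrum is discrete: there is a sequence of eigenvalues $\lambda_1(\Omega)<\lambda_2(\Omega)\le\dots$, $\lambda_k(\Omega)\to\infty$, with a corresponding complete orthonormal system of eigenfunctions in $L^2(\Omega)$. *)

(* Defs.v *)
From HB Require Import structures.
From mathcomp Require Import all_boot all_order all_algebra.
From mathcomp Require Import all_classical all_reals all_analysis.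
From mathcomp Require Import measurable_realfun complex.

Set Implicit Arguments.
Unset Strict Implicit.
Unset Printing Implicit Defensive.
Import Order.TTheory GRing.Theory Num.Def Num.Theory.
Import numFieldTopology.Exports numFieldNormedType.Exports.

Local Open Scope classical_set_scope.
Local Open Scope ring_scope.
Local Open Scope complex_scope.

(* R^n is 'rV[R]_n, with its library topology and its Borel sigma-algebra. *)
Section borel_matrix.
Context {R : realType} {m n : nat}.

HB.instance Definition _ := @isMeasurable.Build
  (sigma_display (@open 'M[R]_(m, n))) 'M[R]_(m, n) <<s @open 'M[R]_(m, n) >>
  (@sigma_algebra0 _ _ _) (@sigma_algebraC _ _) (@sigma_algebra_bigcup _ _ _).

End borel_matrix.

Section lebesgue_rV.
Context {R : realType}.

Lemma open_measurable_mx m n (U : set 'M[R]_(m, n)) :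
  open U -> measurable U.
Proof. exact: sub_sigma_algebra. Qed.

Lemma continuous_measurable_mxR m n (f : 'M[R]_(m, n) -> R) :
  continuous f -> measurable_fun [set: 'M[R]_(m, n)] f.
Proof.
move=> cf; apply: (measurability _ (RGenOpens.measurableE R)).
move=> _ [_ [a [b ->]] <-]; rewrite setTI.
apply: open_measurable_mx.
by move/continuousP : cf; apply; exact: interval_open.
Qed.

Lemma continuous_measurable_mx m n p q (f : 'M[R]_(m, n) -> 'M[R]_(p, q)) :
  continuous f -> measurable_fun [set: 'M[R]_(m, n)] f.
Proof.
move=> cf; apply: (@measurability _ _ _ _ _ f (@open 'M[R]_(p, q))) => //.
move=> _ [U oU <-]; rewrite setTI.
by apply: open_measurable_mx; move/continuousP : cf; apply.
Qed.

Definition cons_rV n (p : R * 'rV[R]_n) : 'rV[R]_n.+1 :=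
  \row_j oapp (p.2 ord0) p.1 (unlift ord0 j).

Lemma cons_rV0 n (p : R * 'rV[R]_n) i : cons_rV p i ord0 = p.1.
Proof. by rewrite mxE unlift_none. Qed.

Lemma cons_rVS n (p : R * 'rV[R]_n) i j :
  cons_rV p i (lift ord0 j) = p.2 ord0 j.
Proof. by rewrite mxE liftK. Qed.

Lemma rV_ball_rat n (U : set 'rV[R]_n) (x : 'rV[R]_n) : open U -> U x ->
  exists q : 'rV[rat]_n, exists k : nat,
    ball (map_mx (@ratr R) q) k.+1%:R^-1 x /\
    ball (map_mx (@ratr R) q) k.+1%:R^-1 `<=` U.
Proof.
move=> oU Ux.
have /nbhs_ballP[e /= e0 eU] : nbhs x U by exact: open_nbhs_nbhs.
have [k] := ltr_add_invr (divr_gt0 e0 (ltr0n R 2)); rewrite add0r => ke.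
have k0 : 0 < k.+1%:R^-1 :> R by rewrite invr_gt0.
have q_ (j : 'I_n) : {q : rat | `|ratr q - x ord0 j| < k.+1%:R^-1}.
  apply: cid.
  have [|q] := @rat_in_itvoo R (x ord0 j - k.+1%:R^-1) (x ord0 j + k.+1%:R^-1).
    by rewrite ltrBlDr -addrA ltrDl addr_gt0.
  rewrite in_itv/= => qx; exists q.
  by rewrite ltr_distl.
exists (\row_j sval (q_ j)), k; split.
  by split=> // i j; rewrite (ord1 i) !mxE; exact: (svalP (q_ j)).
move=> y [_ qy]; apply: eU; split => // i j.
have := qy i j; rewrite (ord1 i) !mxE /ball/= => qyj.
have := svalP (q_ j); rewrite distrC => qxj.
rewrite (le_lt_trans (ler_distD (ratr (sval (q_ j))) _ _))//.
by rewrite (splitr e) ltrD// (lt_trans _ ke).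
Qed.

Lemma measurable_cons_rV n :
  measurable_fun [set: (measurableTypeR R * 'rV[R]_n)%type] (@cons_rV n).
Proof.
apply: (@measurability _ _ _ _ _ _ (@open 'rV[R]_n.+1)) => //.
move=> _ [U oU <-]; rewrite setTI.
pose F (p : 'rV[rat]_n.+1 * nat) : set 'rV[R]_n.+1 :=
  ball (map_mx (@ratr R) p.1) p.2.+1%:R^-1.
have -> : @cons_rV n @^-1` U =
    \bigcup_(p in [set p | F p `<=` U]) (@cons_rV n @^-1` F p).
  rewrite -preimage_bigcup; congr (_ @^-1` _); apply/seteqP; split => [x Ux|].
    have [q [k [qx qU]]] := rV_ball_rat oU Ux.
    by exists (q, k).
  exact: bigcup_sub.
rewrite bigcup_mkcond; apply: countable_bigcupT_measurable => // -[q k].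
case: ifPn => // _.
have k0 : 0 < k.+1%:R^-1 :> R by rewrite invr_gt0.
rewrite (_ : _ @^-1` _ = (ball (ratr (q ord0 ord0) : R) k.+1%:R^-1) `*`
    (ball (map_mx (@ratr R) (\row_j q ord0 (lift ord0 j))) k.+1%:R^-1));
  last first.
  apply/seteqP; split => -[a v] /=.
  - move=> [_ H]; split => /=.
      by have := H ord0 ord0; rewrite cons_rV0 mxE.
    split=> // i j; have := H ord0 (lift ord0 j).
    by rewrite (ord1 i) cons_rVS !mxE.
  - move=> [Ha [_ Hv]]; split=> // i j; rewrite (ord1 i) mxE.
    have [l ->|->] := unliftP ord0 j; last by rewrite cons_rV0.
    by rewrite cons_rVS; have := Hv ord0 l; rewrite !mxE.
apply: measurableX.
  by apply: open_measurable; exact: ball_open.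
by apply: open_measurable_mx; exact: ball_open.
Qed.

Section lebesgue_rV_step.
Local Open Scope ereal_scope.
Context {n : nat}.
Variable mu : {sigma_finite_measure set 'rV[R]_n -> \bar R}.

Definition lebesgue_rV_step : set 'rV[R]_n.+1 -> \bar R :=
  pushforward (@lebesgue_measure R \x mu) (@cons_rV n).

Let measurable_preimage_cons_rV (A : set 'rV[R]_n.+1) : measurable A ->
  measurable (@cons_rV n @^-1` A : set (measurableTypeR R * 'rV[R]_n)).
Proof.
by move=> mA; rewrite -[X in measurable X]setTI; exact: measurable_cons_rV.
Qed.

Let step0 : lebesgue_rV_step set0 = 0.
Proof. by rewrite /lebesgue_rV_step /pushforward preimage_set0 measure0. Qed.

Let step_ge0 A : 0 <= lebesgue_rV_step A.
Proof. exact: (measure_ge0 (@lebesgue_measure R \x mu)). Qed.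

Let step_sigma_additive : semi_sigma_additive lebesgue_rV_step.
Proof.
move=> F mF tF mUF; rewrite /lebesgue_rV_step /pushforward preimage_bigcup.
apply: measure_semi_sigma_additive.
- by move=> i; exact: measurable_preimage_cons_rV.
- apply/trivIsetP => /= i j _ _ ij; rewrite -preimage_setI.
  by move/trivIsetP : tF => /(_ _ _ _ _ ij) ->//; rewrite preimage_set0.
- by rewrite -preimage_bigcup; exact: measurable_preimage_cons_rV.
Qed.

HB.instance Definition _ := isMeasure.Build _ _ _ lebesgue_rV_step
  step0 step_ge0 step_sigma_additive.

Let step_sigma_finite : sigma_finite setT lebesgue_rV_step.
Proof.
have /sigma_finiteP[F [TF ndF Foo]] := sigma_finiteT (@lebesgue_measure R).
have /sigma_finiteP[G [TG ndG Goo]] := sigma_finiteT mu.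
pose hd (v : 'rV[R]_n.+1) : measurableTypeR R := v ord0 ord0.
pose tl (v : 'rV[R]_n.+1) : 'rV[R]_n := \row_j v ord0 (lift ord0 j).
have mhd : measurable_fun [set: 'rV[R]_n.+1] hd.
  by apply: continuous_measurable_mxR => v; exact: coord_continuous.
have mtl : measurable_fun [set: 'rV[R]_n.+1] tl.
  apply: continuous_measurable_mx => v U /= /nbhs_ballP[e /= e0 eU].
  apply/nbhs_ballP; exists e => //= w [_ vw]; apply: eU; split => // i j.
  by rewrite !mxE; exact: vw.
have step_preimage k : @cons_rV n @^-1` (hd @^-1` F k `&` tl @^-1` G k) =
    F k `*` G k.
  have tlK p : tl (cons_rV p) = p.2.
    by apply/rowP => j; rewrite mxE cons_rVS.
  by apply/seteqP; split => p /=; rewrite /hd cons_rV0 tlK.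
exists (fun k => hd @^-1` F k `&` tl @^-1` G k).
  apply/seteqP; split => // v _.
  have [k _ Fk] : (\bigcup_i F i) (hd v) by rewrite -TF.
  have [l _ Gl] : (\bigcup_i G i) (tl v) by rewrite -TG.
  exists (maxn k l) => //; split => /=.
  - by move: Fk; exact/subsetPset/ndF/leq_maxl.
  - by move: Gl; exact/subsetPset/ndG/leq_maxr.
move=> k; have [mFk Fk] := Foo k; have [mGk Gk] := Goo k; split.
  apply: measurableI.
    by rewrite -[X in measurable X]setTI; exact: mhd.
  by rewrite -[X in measurable X]setTI; exact: mtl.
rewrite /lebesgue_rV_step /pushforward step_preimage product_measure1E//.
by rewrite lte_mul_pinfty// ge0_fin_numE.
Qed.

HB.instance Definition _ := Measure_isSigmaFinite.Build _ _ _ lebesgue_rV_step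
  step_sigma_finite.

End lebesgue_rV_step.

Fixpoint lebesgue_rV (n : nat) :
    {sigma_finite_measure set 'rV[R]_n -> \bar R} :=
  match n with
  | 0 => \d_ (0 : 'rV[R]_0)
  | n'.+1 => lebesgue_rV_step (lebesgue_rV n')
  end.

End lebesgue_rV.

Section lebesgue_rV_box.
Local Open Scope ereal_scope.
Context {R : realType}.

Lemma measurable_box n (A : 'I_n -> set R) :
  (forall i, measurable (A i)) ->
  measurable [set v : 'rV[R]_n | forall i, A i (v ord0 i)].
Proof.
move=> mA.
have -> : [set v : 'rV[R]_n | forall i, A i (v ord0 i)] =
    \bigcap_(i in [set: 'I_n]) [set v : 'rV[R]_n | A i (v ord0 i)].
  by apply/seteqP; split => [v Av i _|v Av i]; exact: Av.
apply: fin_bigcap_measurable => // i _.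
have /(_ measurableT _ (mA i)) := @continuous_measurable_mxR R 1 n
  (fun v => v ord0 i) (fun v => @coord_continuous R 1 n ord0 i v).
by rewrite setTI.
Qed.

Lemma lebesgue_rV_box n (A : 'I_n -> set R) :
  (forall i, measurable (A i)) ->
  lebesgue_rV n [set v : 'rV[R]_n | forall i, A i (v ord0 i)] =
  \prod_(i < n) lebesgue_measure (A i).
Proof.
elim: n A => [|n ih] A mA.
  by rewrite big_ord0 /= diracE mem_set// => -[].
pose B := [set v : 'rV[R]_n | forall i, A (lift ord0 i) (v ord0 i)].
have -> : lebesgue_rV n.+1 [set v : 'rV[R]_n.+1 | forall i, A i (v ord0 i)] =
    (@lebesgue_measure R \x lebesgue_rV n) (A ord0 `*` B).
  rewrite /= /lebesgue_rV_step /pushforward; congr (_ _).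
  apply/seteqP; split => p.
    move=> Ap; split => /= [|i]; first by have := Ap ord0; rewrite cons_rV0.
    by have := Ap (lift ord0 i); rewrite cons_rVS.
  move=> [/= Ap0 Ap] i; have [j ->|->] := unliftP ord0 i.
    by rewrite cons_rVS; exact: Ap.
  by rewrite cons_rV0.
have mB : measurable B.
  by apply: (@measurable_box _ (fun i => A (lift ord0 i))) => i; exact: mA.
rewrite product_measure1E//; last exact: mA.
by rewrite big_ord_recl (ih (fun i => A (lift ord0 i)))// => i; exact: mA.
Qed.

End lebesgue_rV_box.

Section euclidean.
Context {R : realType} {d : nat}.
Implicit Types x y : 'rV[R]_d.

Definition dotv x y : R := \sum_(i < d) x ord0 i * y ord0 i.

(* The library norm `|x| on 'rV[R]_d is the sup norm. *)
Definition enorm x : R := Num.sqrt (dotv x x).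

Definition unit_ball : set 'rV[R]_d := [set x | enorm x < 1].

End euclidean.

Section function_spaces.
Context {R : realType} {d : nat}.
Implicit Types (f g phi psi : 'rV[R]_d -> R[i]) (Omega : set 'rV[R]_d).

Local Notation mu := (lebesgue_rV d).

Definition cintegral (D : set 'rV[R]_d) f : R[i] :=
  (\int[mu]_(x in D) complex.Re (f x)) +i* (\int[mu]_(x in D) complex.Im (f x)).

(* Meant for integrable phi; this covers L2 Omega when Omega has finite
   measure, since then L^2(Omega) is contained in L^1(R^d). *)
Definition fourier phi (xi : 'rV[R]_d) : R[i] :=
  cintegral setT (fun x => (cos (dotv x xi) -i* sin (dotv x xi)) * phi x).

(* Elements are Borel representatives, two of which are identified when they
   agree almost everywhere. *)
Definition L2 Omega : set ('rV[R]_d -> R[i]) :=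
  [set f : 'rV[R]_d -> R[i] |
  [/\ measurable_fun setT (fun x => complex.Re (f x) : R),
      measurable_fun setT (fun x => complex.Im (f x) : R),
      (\int[mu]_x (Normc.normc (f x) ^+ 2)%:E < +oo)%E &
      forall x, ~ Omega x -> f x = 0]].

Definition L2_inner Omega f g : R[i] :=
  cintegral Omega (fun x => f x * conjc (g x)).

Fixpoint is_Ck (k : nat) (f : 'rV[R]_d -> R) : Prop :=
  match k with
  | 0 => continuous f
  | k'.+1 => continuous f /\ forall i : 'I_d,
      (forall x, derivable f x (delta_mx ord0 i)) /\
      is_Ck k' (fun x => 'D_(delta_mx ord0 i) f x)
  end.

Definition test_functions Omega : set ('rV[R]_d -> R[i]) :=
  [set f : 'rV[R]_d -> R[i] |
  [/\ forall k, is_Ck k (fun x => complex.Re (f x)),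
      forall k, is_Ck k (fun x => complex.Im (f x)),
      compact (closure [set x | f x != 0]) &
      closure [set x | f x != 0] `<=` Omega]].

Definition star_norm phi : \bar R :=
  sqrte (\int[mu]_xi
    (ln (expR 1 + enorm xi) * Normc.normc (fourier phi xi) ^+ 2)%:E).

Definition form_domain Omega : set ('rV[R]_d -> R[i]) :=
  [set phi : 'rV[R]_d -> R[i] |
  [/\ L2 Omega phi, (star_norm phi < +oo)%E &
      forall e : R, 0 < e -> exists2 u, test_functions Omega u &
        (star_norm (fun x => phi x - u x)%R < e%:E)%E]].

(* The library's ln vanishes at 0, so the integrand is defined everywhere. *)
Definition log_form phi psi : R[i] :=
  ((2 * pi) ^- d)%:C * cintegral setT
    (fun xi => (ln (enorm xi))%:C * (fourier phi xi * conjc (fourier psi xi))).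

Definition is_eigenfunction Omega (lambda : R) phi : Prop :=
  [/\ form_domain Omega phi,
      ~ {ae mu, forall x, phi x = 0} &
      forall psi, form_domain Omega psi ->
        log_form phi psi = lambda%:C * L2_inner Omega phi psi].

Definition complete_orthonormal Omega (phi : nat -> 'rV[R]_d -> R[i]) : Prop :=
  [/\ forall k, L2 Omega (phi k),
      forall j k, L2_inner Omega (phi j) (phi k) = (j == k)%:R &
      forall f, L2 Omega f -> (forall k, L2_inner Omega f (phi k) = 0) ->
        {ae mu, forall x, f x = 0}].

(* lambda is the sequence of all eigenvalues, repeated according to
   multiplicity: this is expressed by the existence of a complete orthonormal
   system of eigenfunctions. Indices start at 0, so lambda k is the (k+1)-st
   eigenvalue. *)
Definition dirichlet_eigenvalues Omega (lambda : nat -> R) : Prop :=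
  [/\ lambda 0%N < lambda 1%N,
      nondecreasing_seq lambda,
      lambda k @[k --> \oo] --> +oo &
      exists2 phi : nat -> 'rV[R]_d -> R[i], complete_orthonormal Omega phi &
        forall k, is_eigenfunction Omega (lambda k) (phi k)].

End function_spaces.

(* Main.v *)
From HB Require Import structures.
Require Import Defs.
From mathcomp Require Import all_boot all_order all_algebra.
From mathcomp Require Import all_classical all_reals all_analysis.
From mathcomp Require Import measurable_realfun complex ring lra.

Import Order.TTheory GRing.Theory Num.Theory.
Import numFieldTopology.Exports numFieldNormedType.Exports.

Local Open Scope classical_set_scope.
Local Open Scope ring_scope.

(** Write [lambda - lambda_k] as the integral of [(lambda - ln |xi|) |phi_k^(xi)|^2]
    against [(2 pi)^-d dxi], using the eigenvalue equation tested on [phi_k] and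
    Plancherel's formula, and bound it by the integral of
    [(lambda - ln |xi|)_+ |phi_k^(xi)|^2].  For fixed [xi] the numbers
    [phi_k^(xi)] are the coefficients of [e^(i x.xi)] restricted to [Omega] in
    an orthonormal system, so Bessel's inequality gives
    [\sum_k |phi_k^(xi)|^2 <= |Omega|]; what remains is the integral of
    [(lambda - ln |xi|)_+], a layer-cake computation.

    Plancherel's formula for [f] in [L^2(Omega)] is obtained by damping
    [|f^|^2] with [prod_j e^(-|xi_j| / N)].  By Fubini the damped integral equals
    [(2 pi)^d |f|_2^2] minus half the integral of [|f(x) - f(y)|^2 P_N(x - y)],
    with [P_N] the product of one-dimensional Poisson kernels.  This
    discrepancy is a quadratic form bounded by a multiple of [|f|_2^2]; as
    [N] tends to infinity it vanishes on indicators of boxes, hence on bounded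
    Borel sets by Dynkin's theorem, and hence on all of [L^2]. *)

(** * Integration and boxes in R^n *)

(** The weight e^(-|t| / N) is chosen because it factors over coordinates, makes the integral over
    one frequency and two points absolutely convergent, and has a rational transform with an
    arctangent primitive: every mass it gives to an interval is explicit. Absolute convergence also
    uses |Omega| < oo, which puts L^2(Omega) inside L^1. The squared difference comes from 2st = s^2
    + t^2 - (s - t)^2: the total mass (2 pi)^d of the kernel turns the squares into the main term,
    and the remainder has a sign and a bound uniform in N, so that the functions on which it
    vanishes in the limit form a class closed in L^2.

    On the spectral side the obstacle is to split the integral of (lambda - ln |xi|) |phi_k^|^2, for
    which ln |xi| |phi_k^|^2 has to be integrable. At infinity this is the finiteness of the star
    norm; at the origin it follows from the boundedness of phi_k^, itself a case of Bessel's
    inequality, and the local integrability of the logarithm. The final factor 1 / d is the integral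
    of e^(-d t) over t >= 0, t being the height of the layer. *)

Section integral_rV.
Context {R : realType}.
Local Notation leb := (@lebesgue_measure R).
Local Open Scope ereal_scope.

Lemma measurable_comp_cons_rV n {d'} {T : measurableType d'} (f : 'rV[R]_n.+1 -> T) :
  measurable_fun setT f ->
  measurable_fun setT (fun p : measurableTypeR R * 'rV[R]_n => f (cons_rV p)).
Proof. by move=> mf; apply: (measurableT_comp mf); exact: measurable_cons_rV. Qed.

Lemma ge0_integral_rVS n (f : 'rV[R]_n.+1 -> \bar R) :
  measurable_fun setT f -> (forall v, 0 <= f v) ->
  \int[lebesgue_rV n.+1]_v f v =
  \int[leb]_a \int[lebesgue_rV n]_v f (cons_rV (a, v)).
Proof.
move=> mf f0.
transitivity (\int[pushforward (leb \x lebesgue_rV n) (@cons_rV R n)]_v f v).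
  by [].
rewrite ge0_integral_pushforward//; last exact: measurable_cons_rV.
rewrite preimage_setT fubini_tonelli1; [by []|exact: measurable_comp_cons_rV|by move=> x; exact: f0].
Qed.
Lemma integral_rVS n (f : 'rV[R]_n.+1 -> \bar R) :
  measurable_fun setT f ->
  (leb \x lebesgue_rV n).-integrable setT (fun p => f (cons_rV p)) ->
  \int[lebesgue_rV n.+1]_v f v =
  \int[leb]_a \int[lebesgue_rV n]_v f (cons_rV (a, v)).
Proof.
move=> mf intf.
transitivity (\int[pushforward (leb \x lebesgue_rV n) (@cons_rV R n)]_v f v).
  by [].
rewrite integral_pushforward//; last exact: measurable_cons_rV.
by rewrite preimage_setT -integral12_prod_meas1.
Qed.

Lemma measurable_coord n (i : 'I_n) :
  measurable_fun setT (fun v : 'rV[R]_n => v ord0 i).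
Proof. by apply: continuous_measurable_mxR => v; exact: coord_continuous. Qed.

Lemma measurable_prod_coord n (g : 'I_n -> R -> R) :
  (forall i, measurable_fun setT (g i)) ->
  measurable_fun setT (fun v : 'rV[R]_n => \prod_i g i (v ord0 i))%R.
Proof.
move=> mg; apply: measurable_prod => i _.
by apply: (measurableT_comp (mg i)); exact: measurable_coord.
Qed.

(** Tonelli, peeling off one coordinate at a time. The one-dimensional integrals are supplied as
    reals [c i], so that no product of possibly infinite values arises. *)
Lemma ge0_integral_prod_coord n (g : 'I_n -> R -> R) (c : 'I_n -> R) :
  (forall i, measurable_fun setT (g i)) -> (forall i x, 0 <= g i x)%R ->
  (forall i, \int[leb]_x (g i x)%:E = (c i)%:E) ->
  \int[lebesgue_rV n]_v (\prod_i g i (v ord0 i))%:E = (\prod_i c i)%:E.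
Proof.
elim: n g c => [|n ih] g c mg g0 gc.
  (* In dimension 0 the measure is the unit mass at the only vector, which matches the empty
     product. *)
  rewrite big_ord0 /= integral_dirac//=; last first.
    by apply/measurable_EFinP; exact: measurable_prod_coord.
  by rewrite diracE mem_set// mul1e big_ord0.
rewrite ge0_integral_rVS; last 2 first.
- by apply/measurable_EFinP; exact: measurable_prod_coord.
- by move=> v; rewrite lee_fin prodr_ge0.
under eq_integral => a _.
  under eq_integral => v _.
    rewrite big_ord_recl cons_rV0 /=.
    under eq_bigr do rewrite cons_rVS.
    rewrite EFinM.
    over.
  rewrite ge0_integralZl//; last 3 first.
  - apply/measurable_EFinP.
    by apply: (@measurable_prod_coord _ (fun i => g (lift ord0 i))).
  - by move=> v _; rewrite lee_fin prodr_ge0.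
  - by rewrite lee_fin.
  rewrite (ih (fun i => g (lift ord0 i)) (fun i => c (lift ord0 i)))//.
  over.
rewrite ge0_integralZr//; last 3 first.
- exact: ((measurable_EFinP _ _).2 (mg ord0)).
- by move=> x _; rewrite lee_fin.
- rewrite lee_fin prodr_ge0// => i _; rewrite -lee_fin -gc.
  by apply: integral_ge0 => x _; rewrite lee_fin.
by rewrite gc -EFinM [in RHS]big_ord_recl.
Qed.
End integral_rV.

(** * Products of functions of separate variables *)

Section tensor.
Context {d1 d2} {T1 : measurableType d1} {T2 : measurableType d2} {R : realType}.
Variables (m1 : {sigma_finite_measure set T1 -> \bar R}).
Variables (m2 : {sigma_finite_measure set T2 -> \bar R}).
Local Open Scope ereal_scope.

Lemma measurable_tensor (f : T1 -> R) (g : T2 -> R) :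
  measurable_fun setT f -> measurable_fun setT g ->
  measurable_fun setT (fun p : T1 * T2 => f p.1 * g p.2)%R.
Proof.
move=> mf mg; apply: measurable_funM.
- exact: (measurableT_comp mf).
- exact: (measurableT_comp mg).
Qed.

Lemma ge0_integral_tensor (f : T1 -> R) (g : T2 -> R) :
  measurable_fun setT f -> measurable_fun setT g ->
  (forall x, 0 <= f x)%R -> (forall x, 0 <= g x)%R ->
  \int[m1 \x m2]_p (f p.1 * g p.2)%:E =
  \int[m1]_x (f x)%:E * \int[m2]_y (g y)%:E.
Proof.
move=> mf mg f0 g0; rewrite fubini_tonelli1; last 2 first.
- by apply/measurable_EFinP; exact: measurable_tensor.
- by move=> x; rewrite lee_fin mulr_ge0.
rewrite /fubini_F /=; under eq_integral => x _.
  under eq_integral do rewrite EFinM.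
  rewrite ge0_integralZl//; last 3 first.
  - exact/measurable_EFinP.
  - by move=> y _; rewrite lee_fin.
  - by rewrite lee_fin.
  over.
rewrite ge0_integralZr//.
- exact/measurable_EFinP.
- by move=> y _; rewrite lee_fin.
- by apply: integral_ge0 => y _; rewrite lee_fin.
Qed.

(** The two measures stay abstract because the product structure arises in three ways: first
    coordinate against the remaining ones, two points of R^d, and a frequency against a pair of
    points. *)
Lemma integrable_tensor (f : T1 -> R) (g : T2 -> R) :
  m1.-integrable setT (EFin \o f) -> m2.-integrable setT (EFin \o g) ->
  (m1 \x m2).-integrable setT (fun p => (f p.1 * g p.2)%:E).
Proof.
move=> /integrableP[/measurable_EFinP mf fi] /integrableP[/measurable_EFinP mg gi].
apply/integrableP; split.
  by apply/measurable_EFinP; exact: measurable_tensor.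
under eq_integral => p _ do rewrite /= normrM.
rewrite (ge0_integral_tensor (fun x => `|f x|%R) (fun x => `|g x|%R))//.
- apply: lte_mul_pinfty => //; first exact: integral_ge0.
  by rewrite ge0_fin_numE//; exact: integral_ge0.
- exact: measurableT_comp.
- exact: measurableT_comp.
Qed.

Lemma integral_tensor (f : T1 -> R) (g : T2 -> R) :
  m1.-integrable setT (EFin \o f) -> m2.-integrable setT (EFin \o g) ->
  \int[m1 \x m2]_p (f p.1 * g p.2)%:E =
  \int[m1]_x (f x)%:E * \int[m2]_y (g y)%:E.
Proof.
move=> fi gi; rewrite -integral12_prod_meas1; last exact: integrable_tensor.
rewrite /fubini_F /=; under eq_integral => x _.
  under eq_integral do rewrite EFinM.
  rewrite integralZl//.
  over.
rewrite -(fineK (integrable_fin_num measurableT gi)).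
by rewrite integralZr.
Qed.
End tensor.

(** * Open boxes as generators of the Borel sets, and dilations *)

Section boxes.
Context {R : realType} {n : nat}.
Local Notation leb := (@lebesgue_measure R).
Local Notation mu := (@lebesgue_rV R n).

(** No order is imposed on [a i] and [b i]: degenerate boxes are empty. This makes boxes stable
    under intersection and explains the truncation at 0 in [lebesgue_obox]. *)
Definition obox (a b : 'I_n -> R) : set 'rV[R]_n :=
  [set v | forall i, a i < v ord0 i < b i].

Lemma oboxE a b : obox a b = [set v | forall i, `]a i, b i[%classic (v ord0 i)].
Proof. by apply/seteqP; split => v /= H i; have := H i; rewrite /= in_itv. Qed.

Definition oboxes : set_system 'rV[R]_n := [set B | exists a b, B = obox a b].

Lemma measurable_obox a b : measurable (obox a b).
Proof. by rewrite oboxE; exact: (@measurable_box _ _ (fun i => `]a i, b i[%classic)). Qed.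

Lemma obox_setI : setI_closed oboxes.
Proof.
move=> _ _ [a [b ->]] [a' [b' ->]].
exists (fun i => Num.max (a i) (a' i)), (fun i => Num.min (b i) (b' i)).
apply/seteqP; split => [v /= [v1 v2] i|v /= v12]; first 1 last.
  split => i; move: (v12 i); rewrite gt_max lt_min.
    by case/andP => /andP[-> _] /andP[->].
  by case/andP => /andP[_ ->] /andP[_ ->].
move: (v1 i) (v2 i); rewrite gt_max lt_min.
by move=> /andP[-> ->] /andP[-> ->].
Qed.

(** Balls of the sup norm are open cubes, and every open set is a countable union of balls with
    rational centre and radius 1 / (k + 1). *)
Lemma measurable_oboxesE : @measurable _ 'rV[R]_n = <<s oboxes >>.
Proof.
apply/seteqP; split; last first.
  by apply: smallest_sub => [|_ [a [b ->]]];
    [exact: sigma_algebra_measurable|exact: measurable_obox].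
apply: smallest_sub; first exact: smallest_sigma_algebra.
move=> U oU.
pose F (p : 'rV[rat]_n * nat) : set 'rV[R]_n :=
  ball (map_mx (@ratr R) p.1) p.2.+1%:R^-1.
have -> : U = \bigcup_(p in [set p | F p `<=` U]) F p.
  apply/seteqP; split => [x Ux|]; last exact: bigcup_sub.
  have [q [k [qx qU]]] := rV_ball_rat oU Ux.
  by exists (q, k).
rewrite bigcup_mkcond.
apply: (@countable_bigcupT_measurable _ (g_sigma_algebraType oboxes)) => // -[q k].
case: ifPn => // _; apply: sub_gen_smallest.
exists (fun i => ratr (q ord0 i) - k.+1%:R^-1), (fun i => ratr (q ord0 i) + k.+1%:R^-1).
have k0 : 0 < k.+1%:R^-1 :> R by rewrite invr_gt0.
apply/seteqP; split => [v [_ H] i|v /= H].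
  have := H ord0 i; rewrite !mxE /ball/=.
  by rewrite ltr_distlC.
split => // i j; rewrite (ord1 i) !mxE /ball/=.
by have := H j; rewrite ltr_distlC.
Qed.

Lemma lebesgue_obox a b :
  (mu (obox a b) = (\prod_i Num.max (b i - a i) 0)%:E)%E.
Proof.
rewrite oboxE (@lebesgue_rV_box _ _ (fun i => `]a i, b i[%classic))//.
rewrite -prodEFin; apply: eq_bigr => i _.
rewrite lebesgue_measure_itv /= lte_fin; case: ltP => ab.
  by rewrite max_l// subr_ge0 ltW.
by rewrite max_r// subr_le0.
Qed.

Definition ocube (k : R) := obox (fun=> - k) (fun=> k).

Lemma bigcup_ocube : \bigcup_k ocube k%:R = setT.
Proof.
apply/seteqP; split => // v _.
have [k kv] : exists k : nat, forall i, `|v ord0 i| < k%:R.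
  exists (\max_(i < n) (Num.trunc `|v ord0 i|).+1)%N => i.
  apply: (lt_le_trans (truncnS_gt _)); rewrite ler_nat.
  exact: (@leq_bigmax _ (fun i => (Num.trunc `|v ord0 i|).+1)).
by exists k => // i; have := kv i; rewrite ltr_norml.
Qed.

Lemma ocube_ltoo k : (mu (ocube k) < +oo)%E.
Proof. by rewrite lebesgue_obox ltry. Qed.

(** Both sides are measures in [A]. They agree on boxes, a generating family stable under
    intersection, and countably many cubes of finite measure exhaust the space, so uniqueness of
    measures applies. *)
Lemma lebesgue_rV_scale (r : R) (A : set 'rV[R]_n) : 0 < r -> measurable A ->
  (mu [set v | A (r^-1 *: v)] = (r ^+ n)%:E * mu A)%E.
Proof.
move=> r0 mA.
have mS : measurable_fun [set: 'rV[R]_n] (fun v : 'rV[R]_n => r^-1 *: v : 'rV[R]_n).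
  apply: continuous_measurable_mx => v U /= /nbhs_ballP[e /= e0 eU].
  apply/nbhs_ballP; exists (r * e) => /=; first exact: mulr_gt0.
  move=> w [_ vw]; apply: eU; split => // i j; have := vw i j.
  rewrite !mxE /ball/= -mulrBr normrM gtr0_norm ?invr_gt0//.
  by rewrite [r^-1 * _]mulrC ltr_pdivrMr// [e * r]mulrC.
pose m1 : {measure set 'rV[R]_n -> \bar R} := pushforward mu (fun v : 'rV[R]_n => r^-1 *: v : 'rV[R]_n).
have rn0 : 0 <= r ^+ n by rewrite exprn_ge0// ltW.
pose m2 : {measure set 'rV[R]_n -> \bar R} := mscale (NngNum rn0) mu.
rewrite -[LHS]/(m1 mS A) -[RHS]/(m2 A).
apply: (measure_unique oboxes (fun k => ocube k%:R)) => //.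
- exact: measurable_oboxesE.
- exact: obox_setI.
- by move=> k; do 2 eexists.
- exact: bigcup_ocube.
- move=> _ [a [b ->]].
  rewrite -[LHS]/(mu ((fun v : 'rV[R]_n => r^-1 *: v) @^-1` (obox a b))).
  rewrite -[RHS]/((r ^+ n)%:E * mu (obox a b))%E.
  have -> : (fun v : 'rV[R]_n => r^-1 *: v) @^-1` (obox a b) = obox (fun i => r * a i) (fun i => r * b i).
    by apply/seteqP; split => v /= H i; have := H i;
      rewrite mxE ltr_pdivlMl// ltr_pdivrMl.
  rewrite !lebesgue_obox -EFinM; congr EFin.
  rewrite -[X in r ^+ X]card_ord -prodr_const -big_split/=.
  apply: eq_bigr => i _; rewrite -mulrBr.
  by rewrite [RHS]maxr_pMr ?mulr0// ltW.
- move=> k; rewrite -[X in (X < _)%E]/(mu ((fun v : 'rV[R]_n => r^-1 *: v) @^-1` (ocube k%:R))).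
  apply: le_lt_trans (ocube_ltoo (r * k%:R)).
  apply: le_measure; rewrite ?inE.
  + by rewrite -[X in measurable X]setTI; apply: mS => //; exact: measurable_obox.
  + exact: measurable_obox.
  + by move=> v /= H i; have := H i; rewrite mxE ltr_pdivlMl// ltr_pdivrMl// mulrN.
Qed.
End boxes.

(** * The Poisson kernel *)

Section kernel1.
Context {R : realType}.
Local Notation leb := (@lebesgue_measure R).
Implicit Types (f F : R -> R) (N t x y : R).

(** Folding the line at 0 removes the absolute value in [expw], so that the fundamental theorem of
    calculus can be applied to a smooth integrand on [0, +oo[. *)
Lemma integral_half_lines f : measurable_fun setT f -> (forall x, 0 <= f x) ->
  (\int[leb]_x (f x)%:E = \int[leb]_(x in `[0%R, +oo[) (f x + f (- x))%:E)%E.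
Proof.
move=> mf f0.
have mfE : measurable_fun setT (EFin \o f) by exact: ((measurable_EFinP _ _).2 mf).
have mfN : measurable_fun setT (fun x => f (- x)).
  exact: (measurableT_comp mf (@oppr_measurable R setT)).
have mfNE : measurable_fun setT (fun x => (f (- x))%:E).
  exact: ((measurable_EFinP _ _).2 mfN).
under [RHS]eq_integral do rewrite EFinD.
rewrite ge0_integralD//; last 4 first.
- by move=> x _; rewrite lee_fin.
- exact: measurable_funTS.
- by move=> x _; rewrite lee_fin.
- exact: measurable_funTS.
rewrite (ge0_integration_by_substitution0 mfNE)//; last first.
  by move=> x; rewrite lee_fin.
under [X in (_ = _ + X)%E]eq_integral do rewrite opprK.
rewrite addeC -(integral_itv_bndo_bndc (measurable_funTS mfE)).
rewrite -ge0_integral_setU//=.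
- by rewrite -itv_bndbnd_setU// set_itvNyy.
- exact: measurable_funTS.
- by move=> x _; rewrite lee_fin.
- apply/disj_setPS => x [/=]; rewrite !in_itv/= andbT => x1 x2.
  by move: (le_lt_trans x2 x1); rewrite ltxx.
Qed.

Lemma ge0_FTC0y f F (l : R) : (forall x, 0 <= x -> 0 <= f x) ->
  continuous f -> F x @[x --> +oo] --> l ->
  (forall x, is_derive x (1 : R) F (f x)) ->
  (\int[leb]_(x in `[0%R, +oo[) (f x)%:E = (l - F 0)%:E)%E.
Proof.
move=> f0 cf Fl dF; rewrite EFinB; apply: ge0_continuous_FTC2y => //.
- exact: continuous_subspaceT.
- apply: cvg_at_right_filter; apply: differentiable_continuous.
  by apply/derivable1_diffP; have [] := dF 0.
- by move=> x _; rewrite derive1E; have [_ ->] := dF x.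
Qed.

(* [poisson N] is the Fourier transform of [expw N], i.e. [2 e / (e^2 + t^2)]
   for [e = 1 / N]. *)
Definition expw N x : R := expR (- (`|x| / N)).

Definition poisson N t : R := 2 * N / (1 + (N * t) ^+ 2).

Lemma expw_ge0 N x : 0 <= expw N x. Proof. exact: expR_ge0. Qed.

Lemma measurable_expw N : measurable_fun setT (expw N).
Proof.
apply: measurableT_comp; first exact: measurable_expR.
apply: measurableT_comp => //; apply: measurable_funM => //.
Qed.

Lemma poisson_ge0 N t : 0 < N -> 0 <= poisson N t.
Proof. by move=> N0; rewrite divr_ge0 ?mulr_ge0// ?addr_ge0 ?sqr_ge0// ltW. Qed.

Lemma oneDsqrM_neq0 N t : 1 + (N * t) ^+ 2 != 0.
Proof. by rewrite gt_eqF// ltr_wpDr ?sqr_ge0. Qed.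

Lemma continuous_poisson N : continuous (poisson N).
Proof.
move=> x; apply: cvgM; first exact: cvg_cst.
apply: cvgV; first exact: oneDsqrM_neq0.
apply: cvgD; first exact: cvg_cst.
apply: (cvg_comp ( *%R N) (fun z => z ^+ 2)); last exact: exprn_continuous.
by apply: cvgMl_tmp; exact: cvg_id.
Qed.

Lemma measurable_poisson N : measurable_fun setT (poisson N).
Proof. by apply: continuous_measurable_fun; exact: continuous_poisson. Qed.

Lemma poissonN N t : poisson N (- t) = poisson N t.
Proof. by rewrite /poisson mulrN sqrrN. Qed.

Lemma cvgy_expRN N : 0 < N -> expR (- (x / N)) @[x --> +oo] --> (0 : R).
Proof.
move=> N0; apply: (cvg_comp (fun x => x / N) (fun x => expR (- x)));
  last exact: cvgr_expR.
by apply: gt0_cvgMly; rewrite ?invr_gt0//; exact: cvg_id.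
Qed.

Lemma cvgy_atanM N x : 0 < N -> atan (N * (y + x)) @[y --> +oo] --> (pi / 2 : R).
Proof.
move=> N0; apply: (cvg_comp (fun y => N * (y + x)) atan); last exact: cvgy_atan.
apply: gt0_cvgMry => //.
by under eq_cvg do rewrite addrC; exact: cvg_addrl.
Qed.

Lemma integral_poisson N x : 0 < N ->
  (\int[leb]_y (poisson N (x - y))%:E = (2 * pi)%:E)%E.
Proof.
move=> N0.
have mp : measurable_fun setT (fun y => poisson N (x - y)).
  apply: (measurableT_comp (measurable_poisson N)).
  exact: measurable_funB.
rewrite integral_half_lines//; last by move=> y; exact: poisson_ge0.
pose f y := poisson N (x - y) + poisson N (x - - y).
(* 2 atan (N t) is a primitive of [poisson N]. The two arctangents cancel at y = 0 and each tends to
   pi / 2, whence 2 pi. *)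
pose F y := 2 * atan (N * (y + - x)) + 2 * atan (N * (y + x)).
have dF y : is_derive y (1 : R) F (f y).
  apply: is_derive_eq.
  rewrite /f -(poissonN N (x - y)) opprB opprK [x + y]addrC /poisson.
  rewrite subr0 addr0 /GRing.scale /= !mulr1.
  by field; rewrite !oneDsqrM_neq0.
rewrite (@ge0_FTC0y f F (2 * pi) _ _ _ dF).
- by rewrite /F !add0r mulrN atanN mulrN addNr subr0.
- by move=> y _; rewrite addr_ge0// poisson_ge0.
- move=> y; apply: cvgD.
    apply: (cvg_comp (fun y => x - y) (poisson N)); last exact: continuous_poisson.
    by apply: cvgB; [exact: cvg_cst|exact: cvg_id].
  apply: (cvg_comp (fun y => x - - y) (poisson N)); last exact: continuous_poisson.
  by apply: cvgB; [exact: cvg_cst|apply: cvgN; exact: cvg_id].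
- rewrite (_ : 2 * pi = 2 * (pi / 2) + 2 * (pi / 2)); last by field.
  by apply: cvgD; apply: cvgMl_tmp; exact: cvgy_atanM.
Qed.

Lemma integral_poisson_itv N x a b : 0 < N -> a < b ->
  (\int[leb]_y (poisson N (x - y) * \1_(`]a, b[%classic) y)%:E =
   (2 * (atan (N * (b - x)) - atan (N * (a - x))))%:E)%E.
Proof.
move=> N0 ab.
transitivity (\int[leb]_(y in `]a, b[) (poisson N (x - y))%:E)%E.
  rewrite [RHS]integral_mkcond; apply: eq_integral => y _.
  by rewrite epatch_indic/= EFinM.
have cp : continuous (fun y => poisson N (x - y)).
  move=> y; apply: (cvg_comp (fun y => x - y) (poisson N)); last exact: continuous_poisson.
  by apply: cvgB; [exact: cvg_cst|exact: cvg_id].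
rewrite -(@integral_itv_bndoo _ a b _ true false); last first.
  apply: measurable_funTS; apply: ((measurable_EFinP _ _).2 _).
  exact: continuous_measurable_fun.
pose F y := 2 * atan (N * (y + - x)).
have dF y : is_derive y (1 : R) F (poisson N (x - y)).
  apply: is_derive_eq.
  rewrite -(poissonN N (x - y)) opprB /poisson.
  rewrite subr0 /GRing.scale /= !mulr1.
  by field; rewrite !oneDsqrM_neq0.
have dcF z : {for z, continuous F}.
  by apply: differentiable_continuous; apply/derivable1_diffP; have [] := dF z.
rewrite (@continuous_FTC2 _ _ F)//.
- by rewrite -EFinB /F -mulrBr.
- exact: continuous_subspaceT.
- split.
  + by move=> z _; have [] := dF z.
  + apply: cvg_at_right_filter; exact: dcF.
  + apply: cvg_at_left_filter; exact: dcF.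
- by move=> z _; rewrite derive1E; have [_ ->] := dF z.
Qed.

(** The added 1 makes the integrand nonnegative when [g] is a cosine or a sine, so the version of
    the fundamental theorem for nonnegative functions on a half-line applies. The bracket
    [2 + g x + g (- x)] is the folded form of [1 + g x], and [integral_expw_sub] takes the 1 away
    again. *)
Lemma integral_expw_FTC N (g G : R -> R) : 0 < N ->
  measurable_fun setT g -> (forall x, 0 <= 1 + g x) ->
  continuous (fun x => 2 + g x + g (- x)) ->
  (forall x, is_derive x (1 : R) G (expR (- (x / N)) * (2 + g x + g (- x)))) ->
  G x @[x --> +oo] --> (0 : R) ->
  (\int[leb]_x (expw N x * (1 + g x))%:E = (- G 0)%:E)%E.
Proof.
move=> N0 mg g0 cg dG G0.
rewrite integral_half_lines; last 2 first.
- apply: measurable_funM; first exact: measurable_expw.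
  exact: measurable_funD.
- by move=> x; rewrite mulr_ge0 ?expw_ge0.
under eq_integral => x.
  rewrite inE/= in_itv/= andbT => x0.
  rewrite /expw normrN ger0_norm// -mulrDr.
  rewrite (_ : 1 + g x + (1 + g (- x)) = 2 + g x + g (- x)); last by ring.
  over.
rewrite (ge0_FTC0y _ _ _ _ _ G0 dG) ?sub0r//.
- move=> x x0; rewrite mulr_ge0 ?expR_ge0//.
  rewrite (_ : 2 + g x + g (- x) = 1 + g x + (1 + g (- x))); last by ring.
  by rewrite addr_ge0.
- move=> x; apply: cvgM; last exact: cg.
  apply: (cvg_comp (fun x => - (x / N)) expR); last exact: continuous_expR.
  by apply: cvgN; apply: cvgMr_tmp; exact: cvg_id.
Qed.

Lemma integral_expw1 N : 0 < N -> (\int[leb]_x (expw N x)%:E = (2 * N)%:E)%E.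
Proof.
move=> N0; under eq_integral => x _ do rewrite -[expw N x]mulr1 -[1]addr0.
pose G x : R := - (2 * N) * expR (- (x / N)).
have dG x : is_derive x (1 : R) G (expR (- (x / N)) * (2 + (cst 0 x : R) + cst 0 (- x))).
  apply: is_derive_eq; rewrite /cst /GRing.scale/=.
  by field; rewrite gt_eqF.
rewrite (integral_expw_FTC _ (cst 0) _ N0 _ _ _ dG)//.
- by rewrite /G mul0r oppr0 expR0 mulr1 opprK.
- by move=> x; rewrite addr0.
- by move=> x; rewrite (_ : (fun x => _) = cst (2 + 0 + 0)); first exact: cvg_cst.
- rewrite -[X in _ --> X](mulr0 (- (2 * N))).
  by apply: cvgMl_tmp; exact: cvgy_expRN.
Qed.

Lemma integrable_expw N : 0 < N -> leb.-integrable setT (EFin \o expw N).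
Proof.
move=> N0; apply/integrableP; split.
  exact: ((measurable_EFinP _ _).2 (measurable_expw N)).
under eq_integral do rewrite /= ger0_norm ?expw_ge0//.
by rewrite integral_expw1// ltry.
Qed.

Lemma measurable_cosM t : measurable_fun setT (fun x => cos (t * x)).
Proof.
apply: continuous_measurable_fun => x.
apply: (cvg_comp ( *%R t) cos); last exact: continuous_cos.
by apply: cvgMl_tmp; exact: cvg_id.
Qed.

Lemma measurable_sinM t : measurable_fun setT (fun x => sin (t * x)).
Proof.
apply: continuous_measurable_fun => x.
apply: (cvg_comp ( *%R t) sin); last exact: continuous_sin.
by apply: cvgMl_tmp; exact: cvg_id.
Qed.

Lemma integrable_expwM N (g : R -> R) : 0 < N -> measurable_fun setT g ->
  (forall x, `|g x| <= 1) ->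
  leb.-integrable setT (fun x => (expw N x * g x)%:E).
Proof.
move=> N0 mg g1; apply: le_integrable (integrable_expw N N0) => //.
  apply: ((measurable_EFinP _ _).2 _).
  by apply: measurable_funM => //; exact: measurable_expw.
by move=> x _; rewrite lee_fin normrM ler_piMr.
Qed.

Lemma integral_expw_sub N (g : R -> R) (c : R) : 0 < N -> measurable_fun setT g ->
  (forall x, `|g x| <= 1) ->
  (\int[leb]_x (expw N x * (1 + g x))%:E = (2 * N + c)%:E)%E ->
  (\int[leb]_x (expw N x * g x)%:E = c%:E)%E.
Proof.
move=> N0 mg g1.
under eq_integral do rewrite mulrDr mulr1 EFinD.
rewrite integralD//; [|exact: integrable_expw|exact: integrable_expwM].
rewrite integral_expw1//.
have : (\int[leb]_x (expw N x * g x)%:E)%E \is a fin_num.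
  by apply: integrable_fin_num => //; exact: integrable_expwM.
by move=> /fineK <-; rewrite -EFinD => -[/addrI ->].
Qed.

Lemma integral_expw_cos N t : 0 < N ->
  (\int[leb]_x (expw N x * cos (t * x))%:E = (poisson N t)%:E)%E.
Proof.
move=> N0; apply: integral_expw_sub => //.
- exact: measurable_cosM.
- by move=> x; rewrite ler_norml cos_geN1 cos_le1.
(* Two integrations by parts give e^(-x / N) (- N cos (t x) + N^2 t sin (t x)) / (1 + (N t)^2) as a
   primitive of e^(-x / N) cos (t x). [G] is twice this, plus the primitive of 2 e^(-x / N). *)
pose c := 2 / (1 + (N * t) ^+ 2).
pose G x := expR (- (x / N)) * (- (2 * N) + c * (- N * cos (t * x) + N ^+ 2 * t * sin (t * x))).
have dG x : is_derive x (1 : R) G (expR (- (x / N)) * (2 + cos (t * x) + cos (t * - x))).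
  apply: is_derive_eq; rewrite /GRing.scale/= [t * - x]mulrN cosN /c.
  by field; rewrite oneDsqrM_neq0 gt_eqF.
have cc : continuous (fun x => cos (t * x)).
  move=> x; apply: (cvg_comp ( *%R t) cos); last exact: continuous_cos.
  by apply: cvgMl_tmp; exact: cvg_id.
rewrite (integral_expw_FTC _ (fun x => cos (t * x)) _ N0 _ _ _ dG).
- rewrite /G mul0r oppr0 expR0 mul1r mulr0 cos0 sin0 mulr0 addr0 mulr1.
  by congr EFin; rewrite /poisson /c; field; rewrite oneDsqrM_neq0.
- exact: measurable_cosM.
- by move=> x; rewrite -lerBlDl sub0r cos_geN1.
- move=> x; rewrite (_ : (fun x => _) = (fun x => 2 + cos (t * x) + cos (t * x))).
    by apply: cvgD; [apply: cvgD; [exact: cvg_cst|]|]; exact: cc.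
  by apply/funext => y; rewrite mulrN cosN.
(* [C] bounds the oscillating factor of [G] uniformly in x, so [G] inherits the decay of the
   exponential. *)
- pose C := 2 * N + `|c| * (N + N ^+ 2 * `|t|) + 1.
  have C0 : 0 < C by rewrite ltr_wpDl// !(addr_ge0, mulr_ge0)// ltW// exprn_gt0.
  apply/cvgrPdist_le => e e0.
  have /cvgrPdist_le /(_ _ (divr_gt0 e0 C0)) := cvgy_expRN N N0.
  apply: filterS => x; rewrite !sub0r !normrN => xe.
  rewrite /G normrM -[e in _ <= e](mulfVK (lt0r_neq0 C0)) ler_pM//.
  rewrite (le_trans (ler_normD _ _))// normrN gtr0_norm ?mulr_gt0//.
  rewrite /C -addrA lerD2l ler_wpDr// normrM ler_wpM2l//.
  rewrite (le_trans (ler_normD _ _))// lerD//.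
    by rewrite mulNr normrN normrM (gtr0_norm N0) ler_piMr ?(ltW N0)// ler_norml cos_geN1 cos_le1.
  rewrite 2!normrM (ger0_norm (exprn_ge0 _ (ltW N0))) ler_piMr//; last first.
    by rewrite ler_norml sin_geN1 sin_le1.
  by rewrite mulr_ge0// exprn_ge0// ltW.
Qed.

Lemma integral_expw_sin N t : 0 < N ->
  (\int[leb]_x (expw N x * sin (t * x))%:E = 0)%E.
Proof.
move=> N0; apply: integral_expw_sub => //.
- exact: measurable_sinM.
- by move=> x; rewrite ler_norml sin_geN1 sin_le1.
pose G x : R := - (2 * N) * expR (- (x / N)).
have dG x : is_derive x (1 : R) G (expR (- (x / N)) * (2 + sin (t * x) + sin (t * - x))).
  apply: is_derive_eq; rewrite /GRing.scale/= [t * - x]mulrN sinN.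
  by field; rewrite gt_eqF.
rewrite (integral_expw_FTC _ (fun x => sin (t * x)) _ N0 _ _ _ dG).
- by rewrite /G mul0r oppr0 expR0 mulr1 opprK addr0.
- exact: measurable_sinM.
- by move=> x; rewrite -lerBlDl sub0r sin_geN1.
- move=> x; rewrite (_ : (fun x => _) = cst 2); first exact: cvg_cst.
  by apply/funext => y; rewrite mulrN sinN addrK.
- rewrite -[X in _ --> X](mulr0 (- (2 * N))).
  by apply: cvgMl_tmp; exact: cvgy_expRN.
Qed.
End kernel1.

(** * Tensor powers of the weight and of the Poisson kernel *)

Section kernel_rV.
Context {R : realType}.
Implicit Types N : R.
Local Notation mu n := (@lebesgue_rV R n).
Local Notation leb := (@lebesgue_measure R).

Lemma measurable_dotv n (t : 'rV[R]_n) : measurable_fun setT (dotv t).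
Proof.
apply: measurable_sum => i; apply: measurable_funM => //.
exact: measurable_coord.
Qed.

Lemma dotv_cons n (t : 'rV[R]_n.+1) a v :
  dotv t (cons_rV (a, v)) = t ord0 ord0 * a + dotv (\row_j t ord0 (lift ord0 j)) v.
Proof.
rewrite /dotv big_ord_recl cons_rV0/=; congr (_ + _).
by apply: eq_bigr => i _; rewrite cons_rVS mxE.
Qed.

Definition expw_rV N n (x : 'rV[R]_n) := \prod_i expw N (x ord0 i).

Definition poisson_rV N n (t : 'rV[R]_n) := \prod_i poisson N (t ord0 i).

Lemma expw_rV_ge0 N n x : 0 <= expw_rV N n x.
Proof. by apply: prodr_ge0 => i _; exact: expw_ge0. Qed.

Lemma measurable_expw_rV N n : measurable_fun setT (expw_rV N n).
Proof. by apply: (measurable_prod_coord n (fun=> expw N)) => i; exact: measurable_expw. Qed.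

Lemma integral_expw_rV N n : 0 < N ->
  (\int[mu n]_x (expw_rV N n x)%:E = ((2 * N) ^+ n)%:E)%E.
Proof.
move=> N0; rewrite (ge0_integral_prod_coord n (fun=> expw N) (fun=> 2 * N)).
- by rewrite prodr_const card_ord.
- by move=> i; exact: measurable_expw.
- by move=> i x; exact: expw_ge0.
- by move=> i; exact: integral_expw1.
Qed.

Lemma integrable_expw_rV N n : 0 < N ->
  (mu n).-integrable setT (EFin \o expw_rV N n).
Proof.
move=> N0; apply/integrableP; split.
  by apply/measurable_EFinP; exact: measurable_expw_rV.
under eq_integral do rewrite /= ger0_norm ?expw_rV_ge0//.
by rewrite integral_expw_rV// ltry.
Qed.

Lemma integrable_expw_rVM N n (g : 'rV[R]_n -> R) : 0 < N ->
  measurable_fun setT g -> (forall x, `|g x| <= 1) ->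
  (mu n).-integrable setT (fun x => (expw_rV N n x * g x)%:E).
Proof.
move=> N0 mg g1; apply: le_integrable (integrable_expw_rV N n N0) => //.
  apply/measurable_EFinP.
  by apply: measurable_funM => //; exact: measurable_expw_rV.
by move=> x _; rewrite lee_fin normrM ler_piMr.
Qed.

Lemma poisson_rV_ge0 N n t : 0 < N -> 0 <= poisson_rV N n t.
Proof. by move=> N0; apply: prodr_ge0 => i _; exact: poisson_ge0. Qed.

Lemma poisson_rVN N n t : poisson_rV N n (- t) = poisson_rV N n t.
Proof. by apply: eq_bigr => i _; rewrite mxE poissonN. Qed.

Lemma integral_poisson_rV N n x : 0 < N ->
  (\int[mu n]_y (poisson_rV N n (x - y))%:E = ((2 * pi) ^+ n)%:E)%E.
Proof.
move=> N0; rewrite /poisson_rV; under eq_integral do under eq_bigr do rewrite !mxE.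
rewrite (ge0_integral_prod_coord n (fun i y => poisson N (x ord0 i - y)) (fun=> 2 * pi)).
- by rewrite prodr_const card_ord.
- move=> i; apply: (measurableT_comp (measurable_poisson N)).
  exact: measurable_funB.
- by move=> i y; exact: poisson_ge0.
- by move=> i; exact: integral_poisson.
Qed.

Lemma cos_norm_le1 (x : R) : `|cos x| <= 1.
Proof. by rewrite ler_norml cos_geN1 cos_le1. Qed.

Lemma sin_norm_le1 (x : R) : `|sin x| <= 1.
Proof. by rewrite ler_norml sin_geN1 sin_le1. Qed.

Lemma measurable_cos : measurable_fun setT (@cos R).
Proof. by apply: continuous_measurable_fun; exact: continuous_cos. Qed.

Lemma measurable_sin : measurable_fun setT (@sin R).
Proof. by apply: continuous_measurable_fun; exact: continuous_sin. Qed.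

Lemma integral_expw_rVS N n (g : 'rV[R]_n.+1 -> R) : 0 < N ->
  measurable_fun setT g -> (forall x, `|g x| <= 1) ->
  (\int[mu n.+1]_x (expw_rV N n.+1 x * g x)%:E =
   \int[leb]_a \int[mu n]_v (expw N a * (expw_rV N n v * g (cons_rV (a, v))))%:E)%E.
Proof.
move=> N0 mg g1.
have expwS a v : expw_rV N n.+1 (cons_rV (a, v)) = expw N a * expw_rV N n v.
  by rewrite /expw_rV big_ord_recl cons_rV0; congr (_ * _); apply: eq_bigr => i _; rewrite cons_rVS.
have mW : measurable_fun setT (fun x : 'rV[R]_n.+1 => (expw_rV N n.+1 x * g x)%:E).
  by apply/measurable_EFinP; apply: measurable_funM => //; exact: measurable_expw_rV.
rewrite integral_rVS; [|exact: mW|]; last first.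
  apply: le_integrable (integrable_tensor _ _ _ _ (integrable_expw N N0) (integrable_expw_rV N n N0)).
  - by [].
  - exact: (measurable_comp_cons_rV _ _ mW).
  - by move=> [a v] _; rewrite lee_fin normrM expwS ler_piMr.
apply: eq_integral => a _; apply: eq_integral => v _.
by rewrite expwS mulrA.
Qed.

(** These are the real and imaginary parts of the transform of the weight. They are proved together
    because the addition formulas for the first coordinate and the rest mix cosines and sines. *)
Lemma integral_expw_rV_cos_sin N n (t : 'rV[R]_n) : 0 < N ->
  (\int[mu n]_x (expw_rV N n x * cos (dotv t x))%:E = (poisson_rV N n t)%:E /\
  \int[mu n]_x (expw_rV N n x * sin (dotv t x))%:E = 0)%E.
Proof.
move=> N0; elim: n t => [|n ih] t.
  rewrite /= !integral_dirac//.
  - rewrite diracE mem_set// !mul1e /expw_rV /poisson_rV /dotv !big_ord0.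
    by rewrite cos0 sin0 mul1r mulr0.
  - apply/measurable_EFinP/measurable_funM; first exact: measurable_expw_rV.
    by apply: (measurableT_comp measurable_sin); exact: measurable_dotv.
  - apply/measurable_EFinP/measurable_funM; first exact: measurable_expw_rV.
    by apply: (measurableT_comp measurable_cos); exact: measurable_dotv.
set t0 := t ord0 ord0; set t' := \row_j t ord0 (lift ord0 j).
have [ihc ihs] := ih t'.
have mdot := measurable_dotv n t'.
have mc := measurableT_comp measurable_cos mdot.
have ms := measurableT_comp measurable_sin mdot.
have ic := integrable_expw_rVM N n _ N0 mc (fun x => cos_norm_le1 (dotv t' x)).
have is_ := integrable_expw_rVM N n _ N0 ms (fun x => sin_norm_le1 (dotv t' x)).
(* By the induction hypothesis only the cosine of the remaining coordinates survives integration. *)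
have lin (b c : R) : (\int[mu n]_v (b * (expw_rV N n v * cos (dotv t' v)) + c * (expw_rV N n v * sin (dotv t' v)))%:E = (b * poisson_rV N n t')%:E)%E.
  under eq_integral do rewrite EFinD !EFinM -!EFinM.
  rewrite integralD//; last 2 first.
  - by under eq_fun do rewrite EFinM; exact: integrableZl.
  - by under eq_fun do rewrite EFinM; exact: integrableZl.
  under eq_integral do rewrite EFinM.
  under [X in (_ + X)%E]eq_integral do rewrite EFinM.
  by rewrite !integralZl// ihc ihs mule0 adde0.
have poissonS : poisson_rV N n.+1 t = poisson N t0 * poisson_rV N n t'.
  rewrite /poisson_rV big_ord_recl; congr (_ * _).
  by apply: eq_bigr => i _; rewrite mxE.
split.
- rewrite integral_expw_rVS//; last 2 first.
  + by apply: (measurableT_comp measurable_cos); exact: measurable_dotv.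
  + by move=> x; exact: cos_norm_le1.
  under eq_integral => a _.
    under eq_integral => v _.
      rewrite dotv_cons cosD -/t0 -/t'.
      rewrite (_ : _ * _ = expw N a * cos (t0 * a) * (expw_rV N n v * cos (dotv t' v)) +
         - (expw N a * sin (t0 * a)) * (expw_rV N n v * sin (dotv t' v))); last by ring.
      over.
    rewrite lin EFinM.
    over.
  rewrite integralZr// ?integral_expw_cos ?poissonS//.
  by apply: integrable_expwM => //; [exact: measurable_cosM|move=> x; exact: cos_norm_le1].
- rewrite integral_expw_rVS//; last 2 first.
  + by apply: (measurableT_comp measurable_sin); exact: measurable_dotv.
  + by move=> x; exact: sin_norm_le1.
  under eq_integral => a _.
    under eq_integral => v _.
      rewrite dotv_cons sinD -/t0 -/t'.
      rewrite (_ : _ * _ = expw N a * sin (t0 * a) * (expw_rV N n v * cos (dotv t' v)) +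
         (expw N a * cos (t0 * a)) * (expw_rV N n v * sin (dotv t' v))); last by ring.
      over.
    rewrite lin EFinM.
    over.
  rewrite integralZr// ?integral_expw_sin ?mul0e//.
  by apply: integrable_expwM => //; [exact: measurable_sinM|move=> x; exact: sin_norm_le1].
Qed.
End kernel_rV.

(** * Plancherel's formula *)

Section discrepancy.
Context {R : realType} (d : nat).
Local Notation mu := (@lebesgue_rV R d).
Local Notation P k t := (@poisson_rV R k.+1%:R d t).
Implicit Types (a b : 'rV[R]_d -> R) (k : nat).

Lemma measurable_poisson_rVB N :
  measurable_fun setT (fun p : 'rV[R]_d * 'rV[R]_d => poisson_rV N d (p.1 - p.2)).
Proof.
apply: measurable_prod => i _.
apply: (measurableT_comp (measurable_poisson N)).
under eq_fun do rewrite !mxE.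
by apply: measurable_funB; exact: (measurableT_comp (measurable_coord d i)).
Qed.

Lemma poisson_rVS_ge0 k t : 0 <= P k t.
Proof. exact: poisson_rV_ge0. Qed.

Lemma integral_fst_poisson k (g : 'rV[R]_d -> R) :
  measurable_fun setT g -> (forall x, 0 <= g x) ->
  (\int[mu \x mu]_p (g p.1 * P k (p.1 - p.2))%:E =
   ((2 * pi) ^+ d)%:E * \int[mu]_x (g x)%:E)%E.
Proof.
move=> mg g0; rewrite fubini_tonelli1; first last.
- by move=> p; rewrite lee_fin mulr_ge0// poisson_rVS_ge0.
- apply/measurable_EFinP/measurable_funM; last exact: measurable_poisson_rVB.
  exact: (measurableT_comp mg).
rewrite /fubini_F /=; under eq_integral => x _.
  under eq_integral do rewrite EFinM.
  rewrite ge0_integralZl//; first last.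
  - by rewrite lee_fin.
  - by move=> y _; rewrite lee_fin poisson_rVS_ge0.
  - apply/measurable_EFinP.
    exact: (@measurableT_comp _ _ _ _ _ _ _ _ _ (measurable_poisson_rVB _) (pair1_measurable x)).
  rewrite integral_poisson_rV// muleC.
  over.
rewrite ge0_integralZl//.
- exact/measurable_EFinP.
- by move=> x _; rewrite lee_fin.
- by rewrite lee_fin exprn_ge0// mulr_ge0// pi_ge0.
Qed.

(** The kernel is even, so the two points may trade places. *)
Lemma integral_snd_poisson k (g : 'rV[R]_d -> R) :
  measurable_fun setT g -> (forall x, 0 <= g x) ->
  (\int[mu \x mu]_p (g p.2 * P k (p.1 - p.2))%:E =
   ((2 * pi) ^+ d)%:E * \int[mu]_x (g x)%:E)%E.
Proof.
move=> mg g0; rewrite -(integral_fst_poisson k)//.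
rewrite fubini_tonelli2; first last.
- by move=> p; rewrite lee_fin mulr_ge0// poisson_rVS_ge0.
- apply/measurable_EFinP/measurable_funM; last exact: measurable_poisson_rVB.
  exact: (measurableT_comp mg).
rewrite fubini_tonelli1; first last.
- by move=> p; rewrite lee_fin mulr_ge0// poisson_rVS_ge0.
- apply/measurable_EFinP/measurable_funM; last exact: measurable_poisson_rVB.
  exact: (measurableT_comp mg).
apply: eq_integral => y _; apply: eq_integral => x _ /=.
by rewrite -opprB poisson_rVN.
Qed.

(** Taken for real [a]: a squared modulus splits into real and imaginary parts, so a complex
    function contributes two such terms. Extended-real values let the estimates below be stated
    before any finiteness is known. *)
Definition disc k a :=
  (\int[mu \x mu]_p ((a p.1 - a p.2) ^+ 2 * P k (p.1 - p.2))%:E)%E.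

Lemma measurable_disc k a : measurable_fun setT a ->
  measurable_fun setT (fun p => (a p.1 - a p.2) ^+ 2 * P k (p.1 - p.2)).
Proof.
move=> ma; apply: measurable_funM; last exact: measurable_poisson_rVB.
apply: measurable_funX; apply: measurable_funB; exact: (measurableT_comp ma).
Qed.

Lemma disc_integrand_ge0 k a p : 0 <= (a p.1 - a p.2) ^+ 2 * P k (p.1 - p.2).
Proof. by rewrite mulr_ge0 ?sqr_ge0 ?poisson_rVS_ge0. Qed.

Lemma disc_ge0 k a : (0 <= disc k a)%E.
Proof. by apply: integral_ge0 => p _; rewrite lee_fin disc_integrand_ge0. Qed.

Lemma discD k a b : measurable_fun setT a -> measurable_fun setT b ->
  (disc k (fun x => a x + b x)%R <= 2%:E * disc k a + 2%:E * disc k b)%E.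
Proof.
move=> ma mb.
have h (c : 'rV[R]_d -> R) : measurable_fun setT c ->
    (2%:E * disc k c = \int[mu \x mu]_p (2 * ((c p.1 - c p.2) ^+ 2 * P k (p.1 - p.2)))%:E)%E.
  move=> mc; under [RHS]eq_integral do rewrite EFinM.
  rewrite ge0_integralZl//.
    by apply/measurable_EFinP; exact: measurable_disc.
  by move=> p _; rewrite lee_fin disc_integrand_ge0.
have mh (c : 'rV[R]_d -> R) : measurable_fun setT c -> measurable_fun setT (fun p : 'rV[R]_d * 'rV[R]_d => (2 * ((c p.1 - c p.2) ^+ 2 * P k (p.1 - p.2)))%:E).
  move=> mc; apply/measurable_EFinP/measurable_funM => //; exact: measurable_disc.
have h0 (c : 'rV[R]_d -> R) (p : 'rV[R]_d * 'rV[R]_d) : (0 <= (2 * ((c p.1 - c p.2) ^+ 2 * P k (p.1 - p.2)))%:E)%E.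
  by rewrite lee_fin mulr_ge0// disc_integrand_ge0.
rewrite !h// -ge0_integralD//; [|exact: mh|exact: mh].
apply: ge0_le_integral => //.
- by move=> p _; rewrite lee_fin (disc_integrand_ge0 k (fun x => a x + b x)).
- by apply/measurable_EFinP; apply: (measurable_disc k (fun x => a x + b x)); exact: measurable_funD.
- by apply: emeasurable_funD; exact: mh.
- move=> p _; rewrite -EFinD lee_fin !mulrA -mulrDl ler_wpM2r ?poisson_rVS_ge0//.
  have := sqr_ge0 ((a p.1 - a p.2) - (b p.1 - b p.2)); nra.
Qed.

Lemma disc_scale k (c : R) a : measurable_fun setT a ->
  (disc k (fun x => c * a x)%R = (c ^+ 2)%:E * disc k a)%E.
Proof.
move=> ma; rewrite -ge0_integralZl//.
- apply: eq_integral => p _; rewrite -EFinM; congr EFin; ring.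
- by apply/measurable_EFinP; exact: measurable_disc.
- by move=> p _; rewrite lee_fin disc_integrand_ge0.
- by rewrite lee_fin sqr_ge0.
Qed.

(** From (s - t)^2 <= 2 s^2 + 2 t^2, where the kernel integrates to (2 pi)^d in either variable.
    That the bound does not depend on [k] is what the limit argument of [disc_vanish_lim] rests
    on. *)
Lemma disc_le k a : measurable_fun setT a ->
  (disc k a <= (4 * (2 * pi) ^+ d)%:E * \int[mu]_x (a x ^+ 2)%:E)%E.
Proof.
move=> ma.
have ma2 : measurable_fun setT (fun x => 2 * a x ^+ 2).
  by apply: measurable_funM => //; exact: measurable_funX.
have a20 x : 0 <= 2 * a x ^+ 2 by rewrite mulr_ge0// sqr_ge0.
have e0 : (((2 * pi) ^+ d)%:E * \int[mu]_x (2 * a x ^+ 2)%:E)%E =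
   ((2 * (2 * pi) ^+ d)%:E * \int[mu]_x (a x ^+ 2)%:E)%E.
  under eq_integral do rewrite EFinM.
  rewrite ge0_integralZl//; last 2 first.
  - by apply/measurable_EFinP; exact: measurable_funX.
  - by move=> x _; rewrite lee_fin sqr_ge0.
  by rewrite muleA -EFinM mulrC.
rewrite (_ : 4 * _ = 2 * (2 * pi) ^+ d + 2 * (2 * pi) ^+ d); last by ring.
rewrite EFinD ge0_muleDl; last 2 first.
- by rewrite lee_fin mulr_ge0// exprn_ge0// mulr_ge0// pi_ge0.
- by rewrite lee_fin mulr_ge0// exprn_ge0// mulr_ge0// pi_ge0.
rewrite -{1}e0 -e0 -{1}(integral_fst_poisson k)// -(integral_snd_poisson k)//.
have m1 : measurable_fun setT (fun p : 'rV[R]_d * 'rV[R]_d => (2 * a p.1 ^+ 2 * P k (p.1 - p.2))%:E).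
  apply/measurable_EFinP/measurable_funM; last exact: measurable_poisson_rVB.
  exact: (measurableT_comp ma2).
have m2 : measurable_fun setT (fun p : 'rV[R]_d * 'rV[R]_d => (2 * a p.2 ^+ 2 * P k (p.1 - p.2))%:E).
  apply/measurable_EFinP/measurable_funM; last exact: measurable_poisson_rVB.
  exact: (measurableT_comp ma2).
rewrite -ge0_integralD//; last 2 first.
- by move=> p _; rewrite lee_fin mulr_ge0// poisson_rVS_ge0.
- by move=> p _; rewrite lee_fin mulr_ge0// poisson_rVS_ge0.
apply: ge0_le_integral => //.
- by move=> p _; rewrite lee_fin disc_integrand_ge0.
- by apply/measurable_EFinP; exact: measurable_disc.
- exact: emeasurable_funD.
- move=> p _; rewrite -EFinD lee_fin -mulrDl ler_wpM2r ?poisson_rVS_ge0//.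
  have := sqr_ge0 (a p.1 + a p.2); nra.
Qed.

(** * The class of functions with vanishing discrepancy *)

Definition disc_vanish a :=
  forall e : R, 0 < e -> \forall k \near \oo, (disc k a <= e%:E)%E.

Lemma disc_vanishD a b : measurable_fun setT a -> measurable_fun setT b ->
  disc_vanish a -> disc_vanish b -> disc_vanish (fun x => a x + b x).
Proof.
move=> ma mb va vb e e0.
have e4 : 0 < e / 4 by rewrite divr_gt0.
apply: filterS2 (va _ e4) (vb _ e4) => k ka kb.
apply: (le_trans (discD k a b ma mb)).
rewrite (_ : e = 2 * (e / 4) + 2 * (e / 4)); last by field.
by rewrite [leRHS]EFinD !EFinM leeD// lee_wpmul2l.
Qed.

Lemma disc_vanishZ (c : R) a : measurable_fun setT a ->
  disc_vanish a -> disc_vanish (fun x => c * a x).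
Proof.
move=> ma va e e0.
(* The summand 1 keeps the division legitimate when c = 0. *)
have c0 : 0 < c ^+ 2 + 1 by rewrite ltr_wpDl// sqr_ge0.
apply: filterS (va _ (divr_gt0 e0 c0)) => k ka.
rewrite disc_scale//; apply: (le_trans (lee_wpmul2l _ ka)).
  by rewrite lee_fin sqr_ge0.
rewrite -EFinM lee_fin mulrCA ler_piMr ?(ltW e0)//.
by rewrite ler_pdivrMr// mul1r lerDl.
Qed.

(** Write a = (a - b) + b: the first term is small for all [k] at once by [disc_le], the second for
    large [k]. The tolerance e / (4 c) gives each of the two terms a share e / 2. *)
Lemma disc_vanish_lim a : measurable_fun setT a ->
  (forall e : R, 0 < e -> exists b, [/\ measurable_fun setT b, disc_vanish b &
     (\int[mu]_x ((a x - b x) ^+ 2)%:E <= e%:E)%E]) ->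
  disc_vanish a.
Proof.
move=> ma H e e0.
pose c : R := 4 * (2 * pi) ^+ d.
have c0 : 0 < c by rewrite mulr_gt0// exprn_gt0// mulr_gt0// pi_gt0.
have [|b [mb vb ab]] := H (e / (4 * c)).
  by rewrite divr_gt0// mulr_gt0.
have e4 : 0 < e / 4 by rewrite divr_gt0.
apply: filterS (vb _ e4) => k kb.
have mab : measurable_fun setT (fun x => a x - b x) by exact: measurable_funB.
have -> : a = (fun x => (a x - b x) + b x) by apply/funext => x; rewrite subrK.
apply: (le_trans (discD k _ b mab mb)).
rewrite (_ : e = 2 * (c * (e / (4 * c))) + 2 * (e / 4)); last first.
  by field; rewrite gt_eqF.
rewrite [leRHS]EFinD; apply: leeD; rewrite EFinM lee_wpmul2l//.
apply: (le_trans (disc_le k _ mab)).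
by rewrite [leRHS]EFinM lee_wpmul2l// lee_fin ltW.
Qed.

Lemma disc0 k : disc k (cst 0) = 0%E.
Proof.
by apply: integral0_eq => p _; rewrite /cst subr0 expr0n mul0r.
Qed.

Lemma disc_vanish0 : disc_vanish (cst 0).
Proof. by move=> e e0; apply: nearW => k; rewrite disc0 lee_fin ltW. Qed.

Lemma disc_vanish_sum (I : Type) (s : seq I) (g : I -> 'rV[R]_d -> R) :
  (forall i, measurable_fun setT (g i)) -> (forall i, disc_vanish (g i)) ->
  disc_vanish (fun x => \sum_(i <- s) g i x).
Proof.
move=> mg vg; elim: s => [|i s ih].
  by under eq_fun do rewrite big_nil; exact: disc_vanish0.
under eq_fun do rewrite big_cons.
by apply: disc_vanishD => //; exact: measurable_sum.
Qed.

Lemma cvg_prodr (I : Type) (s : seq I) (f : I -> nat -> R) (l : I -> R) :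
  (forall i, f i k @[k --> \oo] --> l i) ->
  \prod_(i <- s) f i k @[k --> \oo] --> \prod_(i <- s) l i.
Proof.
move=> fl; elim: s => [|i s ih].
  by rewrite big_nil; under eq_cvg do rewrite big_nil; exact: cvg_cst.
rewrite big_cons; under eq_cvg do rewrite big_cons.
exact: cvgM.
Qed.

(** At an interior point the arguments of the two arctangents tend to +oo and -oo, so each factor
    tends to 2 (pi / 2 + pi / 2). The strict inequalities defining the box are essential here. *)
Lemma cvg_box_mass (alpha beta : 'I_d -> R) (x : 'rV[R]_d) : obox alpha beta x ->
  \prod_i (2 * (atan (k.+1%:R * (beta i - x ord0 i)) - atan (k.+1%:R * (alpha i - x ord0 i))))
    @[k --> \oo] --> ((2 * pi) ^+ d : R).
Proof.
move=> Bx.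
have h (c : R) : 0 < c -> atan (k.+1%:R * c) @[k --> \oo] --> (pi / 2 : R).
  move=> c0; apply: (cvg_comp (fun k : nat => k.+1%:R * c : R) atan); last exact: cvgy_atan.
  apply/cvgryPge => A; near=> k.
  rewrite -ler_pdivrMr// (@le_trans _ _ k%:R)// ?ler_nat//.
  by near: k; exact: nbhs_infty_ger.
have -> : (2 * pi) ^+ d = \prod_(i < d) (2 * pi) :> R by rewrite prodr_const card_ord.
have H i : (2 * (atan (k.+1%:R * (beta i - x ord0 i)) - atan (k.+1%:R * (alpha i - x ord0 i)))) @[k --> \oo] --> (2 * pi : R).
  have /andP[ax xb] := Bx i.
  rewrite (_ : 2 * pi = 2 * (pi / 2 - - (pi / 2))); last by field.
  apply: cvgMl_tmp; apply: cvgB; first by apply: h; rewrite subr_gt0.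
  under eq_cvg do rewrite -opprB mulrN atanN.
  by apply: cvgN; apply: h; rewrite subr_gt0.
exact: cvg_prodr.
Unshelve. end_near.
Qed.

Lemma integral_poisson_box k (alpha beta : 'I_d -> R) (x : 'rV[R]_d) :
  (forall i, alpha i < beta i) ->
  (\int[mu]_y (\1_(obox alpha beta) y * P k (x - y))%:E =
   (\prod_i (2 * (atan (k.+1%:R * (beta i - x ord0 i)) -
      atan (k.+1%:R * (alpha i - x ord0 i)))))%:E)%E.
Proof.
move=> ab.
rewrite -(ge0_integral_prod_coord d
  (fun i y => poisson k.+1%:R (x ord0 i - y) * \1_(`]alpha i, beta i[%classic) y)).
- apply: eq_integral => y _; congr EFin; rewrite big_split/= mulrC; congr (_ * _).
    by apply: eq_bigr => i _; rewrite !mxE.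
  have [yB|yB] := pselect (obox alpha beta y).
    rewrite indicE mem_set// big1// => i _.
    by rewrite indicE mem_set//= in_itv/=; exact: yB.
  rewrite indicE memNset//; apply/esym/eqP/prodf_eq0.
  move/existsNP : yB => [i /negP yi]; exists i => //.
  by rewrite indicE memNset//= in_itv/=; exact/negP.
- move=> i; apply: measurable_funM; last exact: measurable_indic.
  by apply: (measurableT_comp (measurable_poisson _)); exact: measurable_funB.
- by move=> i y; rewrite mulr_ge0 ?poisson_ge0.
- by move=> i; rewrite integral_poisson_itv.
Qed.

(* For an indicator, [(1_B x - 1_B y)^2 = 1_B x + 1_B y - 2 1_B x 1_B y], so the
   claim is that the Poisson mass which [B] receives from its own points tends
   to [(2 pi)^d |B|]. *)
Lemma disc_vanish_box (alpha beta : 'I_d -> R) :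
  disc_vanish (\1_(obox alpha beta) : 'rV[R]_d -> R).
Proof.
set B := obox alpha beta.
have mB : measurable B by exact: measurable_obox.
have m1B : measurable_fun setT (\1_B : 'rV[R]_d -> R) by exact: measurable_indic.
(* The arctangent formula needs nondegenerate sides; a degenerate box is empty and its indicator is
   zero. *)
have [ab|/existsNP[i /negP]] := pselect (forall i, alpha i < beta i); last first.
  rewrite -leNgt => ba; rewrite (_ : \1_B = cst 0); first exact: disc_vanish0.
  apply/funext => x; rewrite indicE memNset// => /(_ i) /andP[ax xb].
  by have := lt_le_trans (lt_trans ax xb) ba; rewrite ltxx.
pose c k (x : 'rV[R]_d) : R := \prod_i (2 * (atan (k.+1%:R * (beta i - x ord0 i)) -
      atan (k.+1%:R * (alpha i - x ord0 i)))).
pose J k := (\int[mu]_x (\1_B x * c k x)%:E)%E.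
have cE k x : (\int[mu]_y (\1_B y * P k (x - y))%:E = (c k x)%:E)%E.
  exact: integral_poisson_box.
have c0 k x : 0 <= c k x.
  rewrite -lee_fin -cE; apply: integral_ge0 => y _.
  by rewrite lee_fin mulr_ge0// poisson_rVS_ge0.
have mP k : measurable_fun setT (fun p : 'rV[R]_d * 'rV[R]_d => (\1_B p.2 * P k (p.1 - p.2))).
  apply: measurable_funM; last exact: measurable_poisson_rVB.
  exact: (measurableT_comp m1B).
(* Measurability comes from Tonelli's theorem, [c k] being a partial integral of a measurable
   function of two points. *)
have mc k : measurable_fun setT (c k).
  apply: ((measurable_EFinP _ _).1 _).
  rewrite (_ : EFin \o c k = fubini_F mu (fun p : 'rV[R]_d * 'rV[R]_d => (\1_B p.2 * P k (p.1 - p.2))%:E)).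
    apply: measurable_fun_fubini_tonelli_F.
      exact/measurable_EFinP.
    by move=> p; rewrite lee_fin mulr_ge0// poisson_rVS_ge0.
  by apply/funext => x; rewrite /fubini_F /= cE.
have cle k x : c k x <= (2 * pi) ^+ d.
  rewrite -lee_fin -cE -(integral_poisson_rV k.+1%:R d x)//.
  apply: ge0_le_integral => //.
  - by move=> y _; rewrite lee_fin mulr_ge0// poisson_rVS_ge0.
  - apply/measurable_EFinP.
    exact: (@measurableT_comp _ _ _ _ _ _ _ _ _ (mP k) (pair1_measurable x)).
  - apply/measurable_EFinP.
    exact: (@measurableT_comp _ _ _ _ _ _ _ _ _ (measurable_poisson_rVB _) (pair1_measurable x)).
  - by move=> y _; rewrite lee_fin ler_piMl ?poisson_rVS_ge0//.
have muB : mu B \is a fin_num.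
  by rewrite lebesgue_obox.
(* Stated as a sum rather than a difference, so that no subtraction of possibly infinite values
   occurs before [J k] is known to be finite. *)
have twoJ k : (disc k \1_B + 2%:E * J k = 2%:E * (((2 * pi) ^+ d)%:E * mu B))%E.
  have JE : (2%:E * J k = \int[mu \x mu]_p (2 * (\1_B p.1 * (\1_B p.2 * P k (p.1 - p.2))))%:E)%E.
    under [RHS]eq_integral do rewrite EFinM.
    rewrite ge0_integralZl//; last 2 first.
    - apply/measurable_EFinP/measurable_funM => //.
      exact: (measurableT_comp m1B).
    - by move=> p _; rewrite lee_fin !mulr_ge0// poisson_rVS_ge0.
    congr (_ * _)%E; rewrite fubini_tonelli1; last 2 first.
    - apply/measurable_EFinP/measurable_funM => //.
      exact: (measurableT_comp m1B).
    - by move=> p; rewrite lee_fin !mulr_ge0// poisson_rVS_ge0.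
    apply: eq_integral => x _; rewrite /fubini_F /=.
    under eq_integral do rewrite EFinM.
    rewrite ge0_integralZl//; last 2 first.
    - apply/measurable_EFinP.
      exact: (@measurableT_comp _ _ _ _ _ _ _ _ _ (mP k) (pair1_measurable x)).
    - by move=> y _; rewrite lee_fin mulr_ge0// poisson_rVS_ge0.
    by rewrite cE EFinM.
  rewrite JE -ge0_integralD//; last 4 first.
  - by move=> p _; rewrite lee_fin disc_integrand_ge0.
  - by apply/measurable_EFinP; exact: measurable_disc.
  - by move=> p _; rewrite lee_fin !mulr_ge0// poisson_rVS_ge0.
  - apply/measurable_EFinP/measurable_funM => //; apply: measurable_funM => //.
    exact: (measurableT_comp m1B).
  have muBE : mu B = (\int[mu]_x (\1_B x)%:E)%E.
    by rewrite integral_indic// setIT.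
  rewrite [RHS](_ : _ = ((2 * pi) ^+ d)%:E * mu B + ((2 * pi) ^+ d)%:E * mu B)%E; last first.
    by rewrite -(fineK muB) -!EFinM -EFinD; congr EFin; ring.
  rewrite [in RHS]muBE -{1}(integral_fst_poisson k)// -(integral_snd_poisson k)//.
  rewrite -ge0_integralD//; last 4 first.
  - by move=> p _; rewrite lee_fin mulr_ge0// poisson_rVS_ge0.
  - apply/measurable_EFinP/measurable_funM; last exact: measurable_poisson_rVB.
    exact: (measurableT_comp m1B).
  - by move=> p _; rewrite lee_fin mulr_ge0// poisson_rVS_ge0.
  - exact/measurable_EFinP.
  apply: eq_integral => p _; rewrite -!EFinD; congr EFin.
  rewrite !indicE; case: (_ \in _); case: (_ \in _) => /=; ring.
(* Dominated convergence: the mass tends to (2 pi)^d at every point of [B], and it never exceeds (2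
   pi)^d on a set of finite measure. *)
have Jcvg : J k @[k --> \oo] --> (((2 * pi) ^+ d)%:E * mu B)%E.
  rewrite (_ : _ * mu B = \int[mu]_x (\1_B x * (2 * pi) ^+ d)%:E)%E; last first.
    under eq_integral do rewrite EFinM.
    rewrite ge0_integralZr//; last 2 first.
    - exact/measurable_EFinP.
    - by rewrite lee_fin exprn_ge0// mulr_ge0// pi_ge0.
    by rewrite integral_indic// setIT muleC.
  apply: (@dominated_cvg _ _ _ _ _ _ _ _ (fun x => (\1_B x * (2 * pi) ^+ d)%:E)) => //.
  - by move=> k; apply/measurable_EFinP; exact: measurable_funM.
  - move=> x _; apply: cvg_EFin; first exact: nearW.
    have [xB|xB] := pselect (B x).
      by rewrite indicE mem_set//; apply: cvgMl_tmp; exact: cvg_box_mass.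
    rewrite indicE memNset// mul0r; under eq_cvg do rewrite /= mul0r.
    exact: cvg_cst.
  - apply/integrableP; split.
      by apply/measurable_EFinP; exact: measurable_funM.
    under eq_integral.
      move=> x _; rewrite gee0_abs; last first.
        by rewrite lee_fin mulr_ge0// exprn_ge0// mulr_ge0// pi_ge0.
      rewrite EFinM; over.
    rewrite ge0_integralZr//; last 2 first.
    - exact/measurable_EFinP.
    - by rewrite lee_fin exprn_ge0// mulr_ge0// pi_ge0.
    have -> : (\int[mu]_x (\1_B x)%:E = mu B)%E by rewrite integral_indic// setIT.
    by rewrite -(fineK muB) -EFinM ltry.
  - by move=> k x _; rewrite lee_fin ger0_norm ?mulr_ge0// ler_wpM2l.
move=> e e0.
have e2 : 0 < e / 2 by rewrite divr_gt0.
move: Jcvg twoJ; rewrite -(fineK muB) -EFinM; set L : R := _ * fine _ => Jcvg twoJ.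
have /fine_cvgP[Jfin Jfcvg] := Jcvg.
move/cvgrPdist_le : Jfcvg => /(_ _ e2).
apply: filterS2 Jfin => k Jk; rewrite /= distrC ler_distlC => /andP[_ H].
move: (twoJ k); rewrite -(fineK Jk) => H2.
rewrite -(@leeD2rE _ (2%:E * (fine (J k))%:E)%E)// H2 -!EFinM -EFinD lee_fin.
rewrite -lerBlDr; move: H; lra.
Qed.

Lemma integral_sqr_indicB (A B : set 'rV[R]_d) : measurable A -> measurable B ->
  B `<=` A -> (mu A < +oo)%E ->
  (\int[mu]_x ((\1_A x - \1_B x) ^+ 2)%:E = mu A - mu B :> \bar R)%E.
Proof.
move=> mA mB BA muA.
have AB : A `&` B = B by apply/setIidPr.
transitivity (mu (A `\` B)); last by rewrite measureD// AB.
transitivity (\int[mu]_x (\1_(A `\` B) x)%:E)%E; last first.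
  by rewrite integral_indic ?setIT//; exact: measurableD.
apply: eq_integral => x _; congr EFin; rewrite !indicE.
have : x \in B -> x \in A by rewrite !inE; exact: BA.
rewrite in_setD; case: (x \in A); case: (x \in B) => /= H; first by ring.
- by ring.
- by have := H isT.
- by ring.
Qed.

(** The intersection with a fixed cube keeps all measures finite, so that complements remain square
    integrable and the class of good sets is a Dynkin system. *)
Lemma disc_vanish_indic (m : nat) (A : set 'rV[R]_d) : measurable A ->
  disc_vanish (\1_(A `&` ocube m%:R) : 'rV[R]_d -> R).
Proof.
set Q := ocube _ => mA.
have mQ : measurable Q by exact: measurable_obox.
have muQ : (mu Q < +oo)%E by exact: ocube_ltoo.
have mIQ B : measurable B -> measurable (B `&` Q) by move=> mB; exact: measurableI.
have m1 B : measurable B -> measurable_fun setT (\1_B : 'rV[R]_d -> R).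
  by move=> mB; exact: measurable_indic.
have muIQ B : measurable B -> (mu (B `&` Q) < +oo)%E.
  move=> mB; apply: le_lt_trans muQ; apply: le_measure; rewrite ?inE//.
  exact: mIQ.
apply: (dynkin_induction (P := fun A => disc_vanish (\1_(A `&` Q) : 'rV[R]_d -> R))
  measurable_oboxesE obox_setI).
- by rewrite setTI; exact: disc_vanish_box.
- move=> B GB; have [a [b ->]] : oboxes (B `&` Q).
    by apply: obox_setI => //; do 2 eexists.
  exact: disc_vanish_box.
- move=> B mB vB.
  rewrite (_ : \1_(~` B `&` Q) = fun x => \1_Q x + -1 * \1_(B `&` Q) x).
    apply: disc_vanishD; [exact: m1|apply: measurable_funM; [exact: measurable_cst|exact: (m1 _ (mIQ _ mB))]| |].
      exact: disc_vanish_box.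
    by apply: disc_vanishZ => //; exact: (m1 _ (mIQ _ mB)).
  apply/funext => x; rewrite !indicE !in_setI in_setC.
  by case: (x \in B); case: (x \in Q) => /=; ring.
- move=> F mF tF vF.
  set A' := \bigcup_k F k `&` Q.
  have mA' : measurable A' by apply: mIQ; exact: bigcupT_measurable.
  (* Finite disjoint unions are handled by linearity. They increase to the full union, whose measure
     is finite, so their indicators converge in L^2 and [disc_vanish_lim] concludes. *)
  pose B n := \big[setU/set0]_(i < n) (F i `&` Q).
  have mB n : measurable (B n) by apply: bigsetU_measurable => i _; exact: mIQ.
  have BE n : B n = \bigcup_(i in `I_n) (F i `&` Q).
    by rewrite /B (bigcup_mkord n (fun i => F i `&` Q)).
  have AE : A' = \bigcup_n B n.
    rewrite /A' setI_bigcupl; apply/seteqP; split => x [i _ Fx].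
      by exists i.+1 => //; rewrite /B big_ord_recr; right.
    move: Fx; rewrite BE => -[j /= _ Fj]; by exists j.
  have ndB : {homo B : n m / (n <= m)%N >-> (n <= m)%O}.
    move=> n m' nm; apply/subsetPset => x; rewrite !BE => -[j /= jn Fj].
    by exists j => //=; exact: leq_trans nm.
  have BA n : B n `<=` A' by rewrite AE; exact: bigcup_sup.
  have Bcvg : mu (B n) @[n --> \oo] --> mu A'.
    by rewrite AE; apply: nondecreasing_cvg_mu => //; rewrite -AE.
  have muA' : (mu A' < +oo)%E by apply: muIQ; exact: bigcupT_measurable.
  have fA' : mu A' \is a fin_num by rewrite ge0_fin_numE.
  apply: disc_vanish_lim; first exact: m1.
  move=> e e0.
  move: Bcvg; rewrite -(fineK fA') => /fine_cvgP[Bfin /cvgrPdist_le /(_ _ e0) H].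
  have [n [/= Bn Hn]] := filter_ex (filterI Bfin H).
  exists (\1_(B n)); split; [exact: m1| |]; last first.
    rewrite integral_sqr_indicB// -(fineK fA') -(fineK Bn) -EFinB lee_fin.
    exact: le_trans (ler_norm _) Hn.
  elim: n {Bn Hn} => [|n ih].
    rewrite /B big_ord0 (_ : \1_set0 = cst 0); first exact: disc_vanish0.
    by apply/funext => x; rewrite indicE in_set0.
  rewrite (_ : \1_(B n.+1) = fun x => \1_(B n) x + \1_(F n `&` Q) x).
    by apply: disc_vanishD; [exact: (m1 _ (mB n))|exact: (m1 _ (mIQ _ (mF n)))|exact: ih|exact: vF].
  apply/funext => x; rewrite {1}/B big_ord_recr/= -/(B n) !indicE in_setU.
  have [xB|xB] := boolP (x \in B n); last by rewrite add0r.
  rewrite memNset ?addr0// => -[Fn Qx].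
  move: xB; rewrite inE BE => -[j /= jn [Fj _]].
  move/trivIsetP : tF => /(_ j n I I); rewrite neq_ltn jn => /(_ isT) /seteqP[/(_ x) + _].
  exact.
- by rewrite -measurable_oboxesE.
Qed.

Import HBNNSimple.

Lemma disc_vanish_nnsfun (m : nat) (f : {nnsfun 'rV[R]_d >-> R}) :
  disc_vanish (fun x => f x * \1_(ocube m%:R) x).
Proof.
rewrite (_ : (fun x => _) = fun x => \sum_(y <- finmap.enum_fset (fset_set (range f))) y * \1_(f @^-1` [set y] `&` ocube m%:R) x).
  apply: disc_vanish_sum => y.
    apply: measurable_funM => //; apply: measurable_indic.
    by apply: measurableI; [exact: measurable_sfunP|exact: measurable_obox].
  apply: disc_vanishZ; last by apply: disc_vanish_indic; exact: measurable_sfunP.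
  apply: measurable_indic; apply: measurableI; last exact: measurable_obox.
  exact: measurable_sfunP.
apply/funext => x; rewrite fimfunE fsbig_finite//= mulr_suml.
by apply: eq_bigr => y _; rewrite indicI /= mulrA.
Qed.

(** Simple functions increasing to [a] are cut off to growing cubes. Since 0 <= g_n <= a, the square
    of a - g_n is dominated by a^2, which gives convergence in L^2. *)
Lemma disc_vanish_ge0 a : measurable_fun setT a -> (forall x, 0 <= a x) ->
  (\int[mu]_x (a x ^+ 2)%:E < +oo)%E -> disc_vanish a.
Proof.
move=> ma a0 aoo.
have maE : measurable_fun setT (EFin \o a) by exact/measurable_EFinP.
pose f := nnsfun_approx measurableT maE.
pose g n x := f n x * \1_(ocube n%:R) x.
have fcvg x : f n x @[n --> \oo] --> a x.
  have := @cvg_nnsfun_approx _ _ _ _ measurableT _ maE (fun x _ => a0 x) x I.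
  by move=> /fine_cvgP[].
have ndf x : nondecreasing_seq (fun n => f n x).
  by move=> n m' nm; exact/lefP/nd_nnsfun_approx.
have fle n x : f n x <= a x.
  have := @nondecreasing_cvgn_le _ _ (ndf x) (cvgP _ (fcvg x)) n.
  by move/cvg_lim : (fcvg x) => ->.
have mg n : measurable_fun setT (g n).
  apply: measurable_funM => //; apply: measurable_indic; exact: measurable_obox.
have g0 n x : 0 <= g n x by rewrite mulr_ge0.
have gle n x : g n x <= a x.
  rewrite (le_trans _ (fle n x))// ler_piMr//.
have gcvg x : g n x @[n --> \oo] --> a x.
  rewrite -[a x]mulr1; apply: cvgM => //.
  have [k _ xk] : (\bigcup_k ocube k%:R) x by rewrite bigcup_ocube.
  apply/cvgrPdist_le => e e0; near=> n.
  rewrite indicE mem_set ?subrr ?normr0 ?(ltW e0)// => i; have /andP[x1 x2] := xk i.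
  have kn : k%:R <= n%:R :> R by rewrite ler_nat; near: n; exact: nbhs_infty_ge.
  by rewrite (lt_le_trans x2 kn) andbT (le_lt_trans _ x1)// lerN2.
apply: disc_vanish_lim => // e e0.
have H : (\int[mu]_x ((a x - g n x) ^+ 2)%:E @[n --> \oo] --> \int[mu]_x (cst 0 x : \bar R))%E.
  apply: (@dominated_cvg _ _ _ _ _ _ _ _ (fun x => (a x ^+ 2)%:E)) => //.
  - by move=> n; apply/measurable_EFinP; apply: measurable_funX; exact: measurable_funB.
  - move=> x _; apply: cvg_EFin; first exact: nearW.
    have h : a x - g n x @[n --> \oo] --> (0 : R).
      by rewrite -(subrr (a x)); apply: cvgB => //; exact: cvg_cst.
    by rewrite -(mulr0 0); exact: (cvgM h h).
  - apply/integrableP; split; first by apply/measurable_EFinP; exact: measurable_funX.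
    by under eq_integral do rewrite gee0_abs ?lee_fin ?sqr_ge0//.
  - move=> n x _; rewrite lee_fin ger0_norm ?sqr_ge0// ler_sqr ?nnegrE ?subr_ge0//.
    by rewrite lerBlDr lerDl.
move: H; rewrite integral0 => /fine_cvgP[Hfin /cvgrPdist_le /(_ _ e0) H].
have [n [/= Hn1 Hn2]] := filter_ex (filterI Hfin H).
exists (g n); split => //; first exact: disc_vanish_nnsfun.
rewrite -(fineK Hn1) lee_fin; apply: le_trans Hn2.
by rewrite distrC subr0 ler_norm.
Unshelve. end_near.
Qed.

Lemma disc_vanish_L2 a : measurable_fun setT a ->
  (\int[mu]_x (a x ^+ 2)%:E < +oo)%E -> disc_vanish a.
Proof.
move=> ma aoo.
have h (b : 'rV[R]_d -> R) : measurable_fun setT b -> (forall x, 0 <= b x) ->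
    (forall x, b x ^+ 2 <= a x ^+ 2) -> disc_vanish b.
  move=> mb b0 ba; apply: disc_vanish_ge0 => //; apply: le_lt_trans aoo.
  apply: ge0_le_integral => //.
  - by move=> x _; rewrite lee_fin sqr_ge0.
  - by apply/measurable_EFinP; exact: measurable_funX.
  - by apply/measurable_EFinP; exact: measurable_funX.
  - by move=> x _; rewrite lee_fin.
have mp : measurable_fun setT (fun x => Num.max (a x) 0) by exact: measurable_maxr.
have mn : measurable_fun setT (fun x => Num.max (- a x) 0).
  by apply: measurable_maxr => //; exact: measurableT_comp.
rewrite (_ : a = fun x => Num.max (a x) 0 + -1 * Num.max (- a x) 0); last first.
  apply/funext => x; case: (leP 0 (a x)) => ax.
    by rewrite max_r ?oppr_le0// mulr0 addr0.
  by rewrite max_l ?oppr_ge0 ?ltW//; ring.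
apply: disc_vanishD => //; first exact: measurable_funM.
  apply: h => // x; first by rewrite le_max lexx orbT.
  by case: (leP 0 (a x)) => // ax; rewrite expr0n sqr_ge0.
apply: disc_vanishZ => //.
apply: h => // x; first by rewrite le_max lexx orbT.
by case: (leP 0 (- a x)) => // ax; rewrite ?sqrrN// expr0n sqr_ge0.
Qed.

Lemma measurable_dotv2 :
  measurable_fun setT (fun p : 'rV[R]_d * 'rV[R]_d => dotv p.1 p.2).
Proof.
apply: measurable_sum => i; apply: measurable_funM;
  exact: (measurableT_comp (measurable_coord d i)).
Qed.

Lemma dotvBl (x y z : 'rV[R]_d) : dotv (x - y) z = dotv x z - dotv y z.
Proof. by rewrite /dotv -sumrB; apply: eq_bigr => i _; rewrite !mxE mulrBl. Qed.

(* An alias of [mu \x mu]: on a bare product measure the sigma-finite instance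
   is shadowed by the one for products of subprobabilities. *)
Definition lebesgue_rV2 : set ('rV[R]_d * 'rV[R]_d) -> \bar R := (mu \x mu)%E.

HB.instance Definition _ := Measure.on lebesgue_rV2.

Let lebesgue_rV2_sigma_finite : sigma_finite setT lebesgue_rV2.
Proof.
exists (fun n => ocube n%:R `*` ocube n%:R).
  apply/seteqP; split => // -[x y] _.
  have [k _ xk] : (\bigcup_k ocube k%:R) x by rewrite bigcup_ocube.
  have [l _ yl] : (\bigcup_k ocube k%:R) y by rewrite bigcup_ocube.
  have ocubeS m n z : (m <= n)%N -> ocube m%:R z -> @ocube R d n%:R z.
    rewrite -(ler_nat R) => mn zm i; have /andP[z1 z2] := zm i.
    by rewrite (lt_le_trans z2 mn) andbT (le_lt_trans _ z1)// lerN2.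
  by exists (maxn k l) => //; split; [apply: ocubeS xk|apply: ocubeS yl];
    rewrite (leq_maxl, leq_maxr).
move=> n; have mQ : measurable (@ocube R d n%:R) by exact: measurable_obox.
split; first exact: measurableX.
rewrite [ltLHS]product_measure1E// lte_mul_pinfty ?ocube_ltoo//.
by rewrite ge0_fin_numE// ocube_ltoo.
Qed.

HB.instance Definition _ := Measure_isSigmaFinite.Build _ _ _ lebesgue_rV2
  lebesgue_rV2_sigma_finite.

(** * The damped identity, and the removal of the damping *)

Section plancherel.
Variables (a b : 'rV[R]_d -> R).
Hypotheses (ia : mu.-integrable setT (EFin \o a))
  (ib : mu.-integrable setT (EFin \o b)).

(** [u] and [v] are the real and imaginary parts of e^(-i x.xi) (a + i b)(x), and [s] dominates both
    uniformly in xi. *)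
Let u xi x : R := cos (dotv x xi) * a x + sin (dotv x xi) * b x.
Let v xi x : R := cos (dotv x xi) * b x - sin (dotv x xi) * a x.
Let s x : R := `|a x| + `|b x|.

Let ma : measurable_fun setT a.
Proof. by have /integrableP[/measurable_EFinP] := ia. Qed.

Let mb : measurable_fun setT b.
Proof. by have /integrableP[/measurable_EFinP] := ib. Qed.

Let is_ : mu.-integrable setT (EFin \o s).
Proof.
rewrite (_ : EFin \o s = (EFin \o (Num.norm \o a)) \+ (EFin \o (Num.norm \o b))); last first.
  by apply/funext => x; rewrite /= EFinD.
by apply: integrableD => //; exact: integrable_norm.
Qed.

Let u_le xi x : `|u xi x| <= s x.
Proof.
rewrite (le_trans (ler_normD _ _))// !normrM lerD// ler_piMl//.
  exact: cos_norm_le1.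
exact: sin_norm_le1.
Qed.

Let v_le xi x : `|v xi x| <= s x.
Proof.
rewrite /s addrC (le_trans (ler_normB _ _))// !normrM lerD// ler_piMl//.
  exact: cos_norm_le1.
exact: sin_norm_le1.
Qed.

Let mu2 : measurable_fun setT (fun p : 'rV[R]_d * 'rV[R]_d => u p.1 p.2).
Proof.
have md : measurable_fun setT (fun p : 'rV[R]_d * 'rV[R]_d => dotv p.2 p.1).
  exact: (measurableT_comp measurable_dotv2 (measurable_fun_pair measurable_snd measurable_fst)).
apply: measurable_funD; apply: measurable_funM.
- exact: (measurableT_comp measurable_cos).
- exact: (measurableT_comp ma).
- exact: (measurableT_comp measurable_sin).
- exact: (measurableT_comp mb).
Qed.

Let mv2 : measurable_fun setT (fun p : 'rV[R]_d * 'rV[R]_d => v p.1 p.2).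
Proof.
have md : measurable_fun setT (fun p : 'rV[R]_d * 'rV[R]_d => dotv p.2 p.1).
  exact: (measurableT_comp measurable_dotv2 (measurable_fun_pair measurable_snd measurable_fst)).
apply: measurable_funB; apply: measurable_funM.
- exact: (measurableT_comp measurable_cos).
- exact: (measurableT_comp mb).
- exact: (measurableT_comp measurable_sin).
- exact: (measurableT_comp ma).
Qed.

Let iu xi : mu.-integrable setT (EFin \o u xi).
Proof.
apply: le_integrable is_ => //.
  apply/measurable_EFinP; exact: (@measurableT_comp _ _ _ _ _ _ _ _ _ mu2 (pair1_measurable xi)).
move=> x _; rewrite lee_fin (le_trans (u_le xi x))// ler_norm//.
Qed.

Let iv xi : mu.-integrable setT (EFin \o v xi).
Proof.
apply: le_integrable is_ => //.
  apply/measurable_EFinP; exact: (@measurableT_comp _ _ _ _ _ _ _ _ _ mv2 (pair1_measurable xi)).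
move=> x _; rewrite lee_fin (le_trans (v_le xi x))// ler_norm//.
Qed.

(** With F(x) = e^(-i x.xi) (a + i b)(x), this is the weight times the real part of F(x) times the
    conjugate of F(y). Integrated over (x, y) it gives the damped squared modulus of the transform;
    integrated over xi it gives the Poisson kernel. *)
Let h k (q : 'rV[R]_d * ('rV[R]_d * 'rV[R]_d)) : R :=
  expw_rV k.+1%:R d q.1 * (u q.1 q.2.1 * u q.1 q.2.2 + v q.1 q.2.1 * v q.1 q.2.2).

Let mh k : measurable_fun setT (h k).
Proof.
have m1 : measurable_fun setT (fun q : 'rV[R]_d * ('rV[R]_d * 'rV[R]_d) => (q.1, q.2.1)).
  by apply: measurable_fun_pair => //; exact: measurableT_comp.
have m2 : measurable_fun setT (fun q : 'rV[R]_d * ('rV[R]_d * 'rV[R]_d) => (q.1, q.2.2)).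
  by apply: measurable_fun_pair => //; exact: measurableT_comp.
apply: measurable_funM.
  exact: (measurableT_comp (measurable_expw_rV _ _)).
apply: measurable_funD; apply: measurable_funM.
- exact: (measurableT_comp mu2 m1).
- exact: (measurableT_comp mu2 m2).
- exact: (measurableT_comp mv2 m1).
- exact: (measurableT_comp mv2 m2).
Qed.

(** Dominated by the weight times 2 s(x) s(y): the weight is what makes the frequency integral
    converge, and [s] is integrable because [a] and [b] are. *)
Let ih k : (mu \x lebesgue_rV2)%E.-integrable setT (EFin \o h k).
Proof.
have iss : (mu \x mu)%E.-integrable setT (EFin \o (fun p => 2 * (s p.1 * s p.2))).
  rewrite (_ : EFin \o _ = (fun p => 2%:E * (s p.1 * s p.2)%:E)%E); last first.
    by apply/funext => p /=; rewrite EFinM.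
  by apply: integrableZl => //; exact: integrable_tensor.
have N0 : 0 < k.+1%:R :> R by [].
have H := integrable_tensor mu lebesgue_rV2 _ _ (integrable_expw_rV k.+1%:R d N0) iss.
apply: le_integrable H => //.
  exact/measurable_EFinP.
move=> q _; rewrite lee_fin normrM [leRHS]normrM ler_wpM2l// [leRHS]ger0_norm; last first.
  by rewrite !mulr_ge0// addr_ge0.
rewrite [leRHS]mulr_natl mulr2n (le_trans (ler_normD _ _))// !normrM lerD// ler_pM//.
Qed.

Let A xi := (\int[mu]_x u xi x)%R.
Let B xi := (\int[mu]_x v xi x)%R.

Let AE xi : (\int[mu]_x (u xi x)%:E = (A xi)%:E)%E.
Proof. by apply/esym/fineK; exact: (integrable_fin_num measurableT (iu xi)). Qed.

Let BE xi : (\int[mu]_x (v xi x)%:E = (B xi)%:E)%E.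
Proof. by apply/esym/fineK; exact: (integrable_fin_num measurableT (iv xi)). Qed.

Let C (p : 'rV[R]_d * 'rV[R]_d) : R := a p.1 * a p.2 + b p.1 * b p.2.

Let integral_h1 k xi : (\int[mu \x mu]_p (h k (xi, p))%:E =
  (expw_rV k.+1%:R d xi * (A xi ^+ 2 + B xi ^+ 2))%:E)%E.
Proof.
have iuu := integrable_tensor mu mu _ _ (iu xi) (iu xi).
have ivv := integrable_tensor mu mu _ _ (iv xi) (iv xi).
under eq_integral do rewrite /h /= EFinM EFinD.
rewrite integralZl//; last exact: integrableD.
rewrite integralD// !integral_tensor// !AE !BE.
by rewrite -!EFinM !expr2.
Qed.

(** The phases at x and y combine into one at x - y. Its cosine part transforms the weight into the
    Poisson kernel, and its sine part integrates to 0. *)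
Let integral_h2 k p : (\int[mu]_xi (h k (xi, p))%:E = (C p * P k (p.1 - p.2))%:E)%E.
Proof.
case: p => x y; have N0 : 0 < k.+1%:R :> R by [].
have md := measurable_dotv d (x - y).
have mc := measurableT_comp measurable_cos md.
have ms := measurableT_comp measurable_sin md.
have ic := integrable_expw_rVM k.+1%:R d _ N0 mc (fun z => cos_norm_le1 (dotv (x - y) z)).
have is' := integrable_expw_rVM k.+1%:R d _ N0 ms (fun z => sin_norm_le1 (dotv (x - y) z)).
have [Ic Is] := integral_expw_rV_cos_sin k.+1%:R d (x - y) N0.
transitivity (\int[mu]_xi ((C (x, y))%:E * (expw_rV k.+1%:R d xi * cos (dotv (x - y) xi))%:E +
   (b x * a y - a x * b y)%:E * (expw_rV k.+1%:R d xi * sin (dotv (x - y) xi))%:E))%E.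
  apply: eq_integral => z _; rewrite -!EFinM -EFinD; congr EFin.
  rewrite /h /C /u /v dotvBl cosB sinB/=; ring.
rewrite integralD//; [|exact: integrableZl|exact: integrableZl].
by rewrite !integralZl// Ic Is mule0 adde0 -EFinM.
Qed.

Let iCP k : (mu \x mu)%E.-integrable setT (fun p => (C p * P k (p.1 - p.2))%:E).
Proof.
(* The bound is the value of the kernel at the origin. *)
have Pk t : `|P k t| <= (2 * k.+1%:R) ^+ d.
  rewrite ger0_norm ?poisson_rVS_ge0//.
  rewrite -[X in _ ^+ X]card_ord -prodr_const ler_prod// => i _.
  rewrite poisson_ge0//= ler_pdivrMr ?ler_peMr// ?ler_wpDr ?sqr_ge0//.
  by rewrite ltr_wpDr ?sqr_ge0.
have iss : (mu \x mu)%E.-integrable setT (fun p => ((2 * k.+1%:R) ^+ d)%:E * (s p.1 * s p.2)%:E)%E.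
  by apply: integrableZl => //; exact: integrable_tensor.
have mC : measurable_fun setT C.
  apply: measurable_funD; apply: measurable_funM.
  - exact: (measurableT_comp ma).
  - exact: (measurableT_comp ma).
  - exact: (measurableT_comp mb).
  - exact: (measurableT_comp mb).
apply: le_integrable iss => //.
  by apply/measurable_EFinP; apply: measurable_funM => //; exact: measurable_poisson_rVB.
move=> p _; rewrite lee_fin [leLHS]normrM [leRHS]normrM [leLHS]mulrC ler_pM//.
  exact: le_trans (Pk _) (ler_norm _).
apply: le_trans (ler_norm _).
rewrite (le_trans (ler_normD _ _))// !normrM /s.
have := normr_ge0 (a p.1); have := normr_ge0 (a p.2).
have := normr_ge0 (b p.1); have := normr_ge0 (b p.2); nra.
Qed.

(** Fubini gives the measurability of the damped function; multiplying by [w], the inverse of the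
    weight with N = 1, removes the damping. *)
Lemma measurable_fourier_norm :
  measurable_fun setT (fun xi : 'rV[R]_d => A xi ^+ 2 + B xi ^+ 2).
Proof.
pose w (xi : 'rV[R]_d) : R := \prod_i expR `|xi ord0 i|.
have mw : measurable_fun setT w.
  apply: (measurable_prod_coord d (fun i x => expR `|x|)) => i.
  by apply: measurableT_comp => //; exact: measurable_expR.
have wW xi : w xi * expw_rV 1%:R d xi = 1.
  rewrite /w /expw_rV -big_split/= big1// => i _.
  by rewrite /expw divr1 expRN divff// gt_eqF// expR_gt0.
rewrite (_ : (fun xi => _) = fun xi => w xi * (expw_rV 1%:R d xi * (A xi ^+ 2 + B xi ^+ 2))); last first.
  by apply/funext => xi; rewrite mulrA wW mul1r.
apply: measurable_funM => //; apply: ((measurable_EFinP _ _).1 _).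
rewrite (_ : EFin \o _ = fubini_F lebesgue_rV2 (EFin \o h 0)).
  by have /integrableP[] := integrable_fubini_F (ih 0).
by apply/funext => xi; exact: (esym (integral_h1 0 xi)).
Qed.

Hypotheses (a2 : (\int[mu]_x (a x ^+ 2)%:E < +oo)%E)
  (b2 : (\int[mu]_x (b x ^+ 2)%:E < +oo)%E).

(** Pointwise, C(x, y) plus half the two squared differences equals g(x) + g(y) with g = (a^2 + b^2)
    / 2; this is then integrated against the kernel. The integrability of both summands on the left
    is needed because [C] has no sign. *)
Lemma plancherel_poisson k :
  (\int[mu]_xi (expw_rV k.+1%:R d xi * (A xi ^+ 2 + B xi ^+ 2))%:E +
    2^-1%:E * (disc k a + disc k b) =
   ((2 * pi) ^+ d)%:E * (\int[mu]_x (a x ^+ 2)%:E + \int[mu]_x (b x ^+ 2)%:E))%E.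
Proof.
under eq_integral do rewrite -integral_h1.
rewrite (Fubini (ih k)).
under eq_integral do rewrite integral_h2.
pose E (p : 'rV[R]_d * 'rV[R]_d) := 2^-1 * ((a p.1 - a p.2) ^+ 2 * P k (p.1 - p.2) + (b p.1 - b p.2) ^+ 2 * P k (p.1 - p.2)).
have mE : measurable_fun setT E.
  by apply: measurable_funM => //; apply: measurable_funD; exact: measurable_disc.
have E0 p : 0 <= E p by rewrite mulr_ge0// addr_ge0// disc_integrand_ge0.
have EE : (2^-1%:E * (disc k a + disc k b) = \int[mu \x mu]_p (E p)%:E)%E.
  under [RHS]eq_integral do rewrite EFinM EFinD.
  rewrite ge0_integralZl//; last 2 first.
  - by apply: emeasurable_funD; apply/measurable_EFinP; exact: measurable_disc.
  - by move=> p _; rewrite adde_ge0// lee_fin disc_integrand_ge0.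
  rewrite ge0_integralD//.
  - by move=> p _; rewrite lee_fin disc_integrand_ge0.
  - by apply/measurable_EFinP; exact: measurable_disc.
  - by move=> p _; rewrite lee_fin disc_integrand_ge0.
  - by apply/measurable_EFinP; exact: measurable_disc.
pose g x := 2^-1 * (a x ^+ 2 + b x ^+ 2).
have mg : measurable_fun setT g.
  by apply: measurable_funM => //; apply: measurable_funD; exact: measurable_funX.
have g0 x : 0 <= g x by rewrite mulr_ge0// addr_ge0// sqr_ge0.
have gE : (\int[mu]_x (g x)%:E = 2^-1%:E * (\int[mu]_x (a x ^+ 2)%:E + \int[mu]_x (b x ^+ 2)%:E))%E.
  under eq_integral do rewrite EFinM EFinD.
  have sq0 (f : 'rV[R]_d -> R) x : (0 <= (f x ^+ 2)%:E)%E by rewrite lee_fin sqr_ge0.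
  have msq (f : 'rV[R]_d -> R) : measurable_fun setT f -> measurable_fun setT (fun x => (f x ^+ 2)%:E).
    by move=> mf; apply/measurable_EFinP; exact: measurable_funX.
  rewrite ge0_integralZl//; last 2 first.
  - by apply: emeasurable_funD; exact: msq.
  - by move=> p _; rewrite adde_ge0.
  by rewrite ge0_integralD//; exact: msq.
have fina : (\int[mu]_x (a x ^+ 2)%:E)%E \is a fin_num.
  by rewrite ge0_fin_numE//; apply: integral_ge0 => x _; rewrite lee_fin sqr_ge0.
have finb : (\int[mu]_x (b x ^+ 2)%:E)%E \is a fin_num.
  by rewrite ge0_fin_numE//; apply: integral_ge0 => x _; rewrite lee_fin sqr_ge0.
rewrite [RHS](_ : _ = ((2 * pi) ^+ d)%:E * \int[mu]_x (g x)%:E + ((2 * pi) ^+ d)%:E * \int[mu]_x (g x)%:E)%E; last first.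
  rewrite gE -(fineK fina) -(fineK finb) -EFinD -!EFinM -EFinD; congr EFin.
  by field.
rewrite -{1}(integral_fst_poisson k)// -(integral_snd_poisson k)//.
have iE : (mu \x mu)%E.-integrable setT (fun p => (E p)%:E).
  apply/integrableP; split; first exact/measurable_EFinP.
  under eq_integral do rewrite gee0_abs ?lee_fin//.
  rewrite -EE lte_mul_pinfty// ?lee_fin//.
  have dfin (c : 'rV[R]_d -> R) : measurable_fun setT c -> (\int[mu]_x (c x ^+ 2)%:E)%E \is a fin_num -> (disc k c < +oo)%E.
    by move=> mc fc; rewrite (le_lt_trans (disc_le _ _ mc))// -(fineK fc) -EFinM ltry.
  by rewrite lte_add_pinfty// dfin.
rewrite EE -integralD//.
rewrite -ge0_integralD//; last 4 first.
- by move=> p _; rewrite lee_fin mulr_ge0// poisson_rVS_ge0.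
- apply/measurable_EFinP/measurable_funM; last exact: measurable_poisson_rVB.
  exact: (measurableT_comp mg).
- by move=> p _; rewrite lee_fin mulr_ge0// poisson_rVS_ge0.
- apply/measurable_EFinP/measurable_funM; last exact: measurable_poisson_rVB.
  exact: (measurableT_comp mg).
apply: eq_integral => p _; rewrite -!EFinD; congr EFin.
by rewrite /C /E /g; field.
Qed.

Let expw_rV_nd (xi : 'rV[R]_d) : nondecreasing_seq (fun k => expw_rV k.+1%:R d xi).
Proof.
move=> m n mn; apply: ler_prod => i _; rewrite expw_ge0/= ler_expR lerN2.
by rewrite ler_wpM2l// lef_pV2 ?posrE// ler_nat ltnS.
Qed.

Let expw_rV_cvg1 (xi : 'rV[R]_d) : expw_rV k.+1%:R d xi @[k --> \oo] --> (1 : R).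
Proof.
rewrite [X in _ --> X](_ : _ = \prod_(i < d) (1 : R)); last by rewrite big1.
apply: cvg_prodr => i; rewrite -[X in _ --> X]expR0.
have lim0 : - (`|xi ord0 i| / k.+1%:R) @[k --> \oo] --> (0 : R).
  rewrite -oppr0; apply: cvgN; rewrite -(mulr0 `|xi ord0 i|).
  by apply: cvgMl_tmp; exact: cvg_harmonic.
exact: (cvg_comp _ _ lim0 (@continuous_expR R 0)).
Qed.

(** One sequence, two limits. The weights increase to 1, so monotone convergence gives the left side
    with no prior knowledge that the transform is square integrable; the vanishing discrepancy gives
    the right side. *)
Lemma plancherel_re_im : (\int[mu]_xi (A xi ^+ 2 + B xi ^+ 2)%:E =
   ((2 * pi) ^+ d)%:E * (\int[mu]_x (a x ^+ 2)%:E + \int[mu]_x (b x ^+ 2)%:E))%E.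
Proof.
set T := (X in _ = X).
pose X xi := A xi ^+ 2 + B xi ^+ 2.
have X0 xi : 0 <= X xi by rewrite addr_ge0 ?sqr_ge0.
have lim1 : (\int[mu]_xi (expw_rV k.+1%:R d xi * X xi)%:E @[k --> \oo] --> \int[mu]_xi (X xi)%:E)%E.
  rewrite [X in _ --> X](_ : _ = \int[mu]_xi limn (fun k => (expw_rV k.+1%:R d xi * X xi)%:E))%E; last first.
    apply: eq_integral => xi _; apply/esym/cvg_lim => //.
    apply: cvg_EFin; first exact: nearW.
    rewrite -[X in _ --> X]mul1r; apply: cvgMr_tmp; exact: expw_rV_cvg1.
  apply: cvg_monotone_convergence => //.
  - move=> k; apply/measurable_EFinP; apply: measurable_funM.
      exact: measurable_expw_rV.
    exact: measurable_fourier_norm.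
  - by move=> k xi _; rewrite lee_fin mulr_ge0// expw_rV_ge0.
  - by move=> xi _ m n mn; rewrite lee_fin ler_wpM2r// expw_rV_nd.
apply: (cvg_unique _ lim1) => //.
have fina : (\int[mu]_x (a x ^+ 2)%:E)%E \is a fin_num.
  by rewrite ge0_fin_numE//; apply: integral_ge0 => x _; rewrite lee_fin sqr_ge0.
have finb : (\int[mu]_x (b x ^+ 2)%:E)%E \is a fin_num.
  by rewrite ge0_fin_numE//; apply: integral_ge0 => x _; rewrite lee_fin sqr_ge0.
have finT : T \is a fin_num by rewrite fin_numM// fin_numD fina.
rewrite -(fineK finT).
have dfin k (c : 'rV[R]_d -> R) : measurable_fun setT c -> (\int[mu]_x (c x ^+ 2)%:E)%E \is a fin_num -> disc k c \is a fin_num.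
  move=> mc fc; rewrite ge0_fin_numE ?disc_ge0//.
  by rewrite (le_lt_trans (disc_le _ _ mc))// -(fineK fc) -EFinM ltry.
rewrite (_ : (fun k => _) = fun k => (fine T - 2^-1 * (fine (disc k a) + fine (disc k b)))%:E); last first.
  apply/funext => k; have := plancherel_poisson k.
  rewrite -/T -(fineK finT) -(fineK (dfin k a ma fina)) -(fineK (dfin k b mb finb)).
  by rewrite -EFinD -EFinM /= => HT; rewrite EFinB -HT addeK.
apply: cvg_EFin; first exact: nearW.
apply/cvgrPdist_le => e e0.
have e2 : 0 < e / 2 by rewrite divr_gt0.
have va := disc_vanish_L2 a ma a2 _ e0.
have vb := disc_vanish_L2 b mb b2 _ e0.
apply: filterS2 va vb => k; rewrite -(fineK (dfin k a ma fina)) -(fineK (dfin k b mb finb)) !lee_fin.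
have := fine_ge0 (disc_ge0 k a); have := fine_ge0 (disc_ge0 k b).
move=> h1 h2 h3 h4; rewrite /= opprB addrC subrK ger0_norm ?mulr_ge0 ?addr_ge0//.
move: h3 h4; lra.
Qed.
End plancherel.
End discrepancy.

(** * The integral of the logarithmic excess *)

Section layer_cake.
Context {R : realType} (d : nat).
Local Notation mu := (@lebesgue_rV R d).
Local Notation leb := (@lebesgue_measure R).

Lemma measurable_enorm : measurable_fun setT (@enorm R d).
Proof.
have ms : measurable_fun setT (@Num.sqrt R).
  by apply: continuous_measurable_fun; exact: sqrt_continuous.
apply: (measurableT_comp ms); apply: measurable_sum => i.
by apply: measurable_funM; exact: measurable_coord.
Qed.

Lemma enorm_ge0 (x : 'rV[R]_d) : 0 <= enorm x.
Proof. exact: sqrtr_ge0. Qed.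

Lemma enormZ (c : R) (x : 'rV[R]_d) : 0 <= c -> enorm (c *: x) = c * enorm x.
Proof.
move=> c0; rewrite /enorm (_ : dotv _ _ = c ^+ 2 * dotv x x).
  by rewrite sqrtrM ?sqr_ge0// sqrtr_sqr ger0_norm.
rewrite /dotv mulr_sumr; apply: eq_bigr => i _; rewrite !mxE; ring.
Qed.

Lemma coord_le_enorm (x : 'rV[R]_d) i : `|x ord0 i| <= enorm x.
Proof.
rewrite -sqrtr_sqr ler_wsqrtr// /dotv (bigD1 i)//= expr2 lerDl.
by apply: sumr_ge0 => j _; rewrite -expr2 sqr_ge0.
Qed.

Lemma measurable_lt_set {d'} {T : measurableType d'} (f g : T -> R) :
  measurable_fun setT f -> measurable_fun setT g ->
  measurable [set x | f x < g x].
Proof.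
move=> mf mg; have := measurable_fun_ltr mf mg.
move=> /(_ measurableT [set true]) H.
rewrite (_ : [set x | f x < g x] = setT `&` (fun x => f x < g x) @^-1` [set true]).
  by apply: H.
by rewrite setTI.
Qed.

Lemma measurable_unit_ball : measurable (@unit_ball R d).
Proof. by apply: measurable_lt_set => //; exact: measurable_enorm. Qed.

Lemma unit_ball_ltoo : (mu (@unit_ball R d) < +oo)%E.
Proof.
apply: le_lt_trans (ocube_ltoo 1); apply: le_measure; rewrite ?inE.
- exact: measurable_unit_ball.
- exact: measurable_obox.
- by move=> x /= x1 i; rewrite -ltr_norml (le_lt_trans (coord_le_enorm x i)).
Qed.

Lemma lebesgue_ball (r : R) : 0 < r ->
  (mu [set x : 'rV[R]_d | (enorm x < r)%R] = (r ^+ d)%:E * mu (@unit_ball R d))%E.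
Proof.
move=> r0; rewrite -lebesgue_rV_scale//; last exact: measurable_unit_ball.
congr (mu _); apply/seteqP; split => x; rewrite /unit_ball /= enormZ ?invr_ge0 ?ltW//;
  by rewrite mulrC ltr_pdivrMr// mul1r.
Qed.

Lemma integral_expRN (c : R) : 0 < c ->
  (\int[leb]_(t in `[0%R, +oo[) (expR (- (c * t)))%:E = (c^-1)%:E)%E.
Proof.
move=> c0; pose F t := - (c^-1) * expR (- (t / c^-1)).
have dF t : is_derive t (1 : R) F (expR (- (c * t))).
  apply: is_derive_eq; rewrite /GRing.scale/= invrK mulr1 mulr0 add0r.
  by rewrite (mulrC t); field; rewrite gt_eqF.
rewrite (ge0_FTC0y _ _ 0 _ _ _ dF).
- by rewrite /F mul0r oppr0 expR0 mulr1 sub0r opprK.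
- by move=> x _; exact: expR_ge0.
- move=> x; apply: (cvg_comp (fun x => - (c * x)) expR); last exact: continuous_expR.
  by apply: cvgN; apply: cvgMl_tmp; exact: cvg_id.
- rewrite -[X in _ --> X](mulr0 (- c^-1)).
  by apply: cvgMl_tmp; apply: cvgy_expRN; rewrite invr_gt0.
Qed.

(** At the origin the convention ln 0 = 0 gives the finite value max(l, 0) in place of +oo, so the
    function stays real-valued. *)
Definition log_excess (l : R) (xi : 'rV[R]_d) : R := Num.max (l - ln (enorm xi)) 0.

Lemma log_excess_ge0 l xi : 0 <= log_excess l xi.
Proof. by rewrite le_max lexx orbT. Qed.

Lemma measurable_ln_enorm : measurable_fun setT (fun xi : 'rV[R]_d => ln (enorm xi)).
Proof. exact: (measurableT_comp (@measurable_ln R) measurable_enorm). Qed.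

Lemma measurable_log_excess l : measurable_fun setT (log_excess l).
Proof.
apply: measurable_maxr => //; apply: measurable_funB => //.
exact: measurable_ln_enorm.
Qed.

(** [S] is the region under the graph. Its slice at height t >= 0 is a ball of radius e^(l - t), of
    volume e^(d l) e^(-d t) |B_d|, and integrating over t gives 1 / d, with d >= 1 ensuring the
    decay. *)
Lemma integral_log_excess (l : R) : (1 <= d)%N ->
  (\int[mu]_xi (log_excess l xi)%:E <=
   (expR (d%:R * l))%:E * mu (@unit_ball R d) * (d%:R^-1)%:E)%E.
Proof.
move=> d1; have d0 : 0 < d%:R :> R by rewrite ltr0n.
pose S : set ('rV[R]_d * measurableTypeR R) :=
  [set p | 0 <= p.2] `&` [set p | enorm p.1 < expR (l - p.2)].
have mS : measurable S.
  apply: measurableI.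
    rewrite (_ : [set _ | _] = ~` [set p | p.2 < 0]).
      apply: measurableC; apply: measurable_lt_set => //; exact: measurable_snd.
    by apply/seteqP; split => p /=; rewrite leNgt => /negP.
  apply: measurable_lt_set; first exact: (measurableT_comp measurable_enorm).
  apply: measurableT_comp; first exact: measurable_expR.
  by apply: measurable_funB => //; exact: measurable_snd.
pose f p : \bar R := (\1_S p)%:E.
have mf : measurable_fun setT f by apply/measurable_EFinP; exact: measurable_indic.
have f0 p : (0 <= f p)%E by rewrite lee_fin.
apply: (@le_trans _ _ (\int[mu]_xi \int[leb]_t f (xi, t))%E).
  apply: ge0_le_integral => //.
  - by move=> xi _; rewrite lee_fin log_excess_ge0.
  - by apply/measurable_EFinP; exact: measurable_log_excess.
  - exact: (measurable_fun_fubini_tonelli_F f mf f0).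
  move=> xi _; rewrite /log_excess.
  set m := Num.max _ _.
  have -> : m%:E = (\int[leb]_t (\1_(`[0%R, m[%classic) t)%:E)%E.
    transitivity (leb `[0%R, m[%classic); last by rewrite integral_indic// setIT.
    rewrite lebesgue_measure_itv/= lte_fin.
    case: ltP => m0; first by rewrite sube0.
    by congr EFin; apply/eqP; rewrite eq_le m0 log_excess_ge0.
  apply: ge0_le_integral => //.
  - by apply: ((measurable_EFinP _ _).2 _); exact: measurable_indic.
  - exact: (measurableT_comp mf (pair1_measurable xi)).
  move=> t _; rewrite lee_fin !indicE ler_nat.
  case: (boolP (t \in _)) => //; rewrite inE/= in_itv/= => /andP[t0 tm].
  rewrite mem_set// /S/=; split => //=.
  move: tm; rewrite lt_max [t < 0]ltNge t0 orbF => tl.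
  (* Over the origin the slice of [S] is the whole half-line, longer than the conventional value of
     the logarithm suggests; hence an inclusion of slices and an inequality. *)
  have [->|x0] := eqVneq (enorm xi) 0; first exact: expR_gt0.
  have xp : 0 < enorm xi by rewrite lt_def x0 enorm_ge0.
  rewrite -ltr_ln ?posrE ?expR_gt0// expRK.
  by rewrite ltrBrDr addrC -ltrBrDr.
rewrite (sfinite_Fubini mu leb)//.
apply: (@le_trans _ _ (\int[leb]_(t in `[0%R, +oo[) ((expR (d%:R * l))%:E * mu (@unit_ball R d) * (expR (- (d%:R * t)))%:E))%E).
  rewrite [leRHS]integral_mkcond.
  rewrite le_eqVlt; apply/orP; left; apply/eqP; apply: eq_integral => t _.
  rewrite patchE; case: ifPn => [|] t0; last first.
    apply: integral0_eq => xi _; rewrite /f indicE memNset//= => -[/= t0'] _.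
    by move/negP : t0; apply; rewrite inE/= in_itv/= t0'.
  have {}t0 : 0 <= t by move: t0; rewrite inE/= in_itv/= andbT.
  transitivity (mu [set xi : 'rV[R]_d | (enorm xi < expR (l - t))%R]).
    transitivity (\int[mu]_xi (\1_[set xi : 'rV[R]_d | (enorm xi < expR (l - t))%R] xi)%:E)%E.
      apply: eq_integral => xi _; rewrite /f !indicE; congr (nat_of_bool _)%:R%:E.
      by apply/idP/idP; rewrite !inE /S/= => // -[].
    rewrite integral_indic ?setIT//.
    by apply: measurable_lt_set => //; exact: measurable_enorm.
  rewrite lebesgue_ball ?expR_gt0// muleAC -EFinM; congr (_%:E * _)%E.
  rewrite -expRM_natl -expRD; congr expR.
  rewrite mulr_natl; ring.
rewrite ge0_integralZl//.
- by rewrite integral_expRN.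
- apply: measurable_funTS; apply: ((measurable_EFinP _ _).2 _).
  apply: measurableT_comp; first exact: measurable_expR.
  by apply: measurableT_comp => //; exact: measurable_funM.
- by rewrite mule_ge0// lee_fin expR_ge0.
Qed.
End layer_cake.

(** * Bessel's inequality *)

Section bessel.
Local Open Scope complex_scope.
Context {R : realType} (d : nat).
Local Notation mu := (@lebesgue_rV R d).
Variable Omega : set 'rV[R]_d.
Hypothesis mOmega : measurable Omega.
Implicit Types f g h : 'rV[R]_d -> R[i].
Local Notation Re := complex.Re.
Local Notation Im := complex.Im.

Lemma normc_sqr (z : R[i]) : Normc.normc z ^+ 2 = Re z ^+ 2 + Im z ^+ 2.
Proof. by case: z => x y /=; rewrite sqr_sqrtr// addr_ge0 ?sqr_ge0. Qed.

Lemma ReM (z w : R[i]) : Re (z * w) = Re z * Re w - Im z * Im w.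
Proof. by case: z; case: w. Qed.

Lemma ImM (z w : R[i]) : Im (z * w) = Re z * Im w + Im z * Re w.
Proof. by case: z; case: w. Qed.

Lemma ReD (z w : R[i]) : Re (z + w) = Re z + Re w.
Proof. by case: z; case: w. Qed.

Lemma ImD (z w : R[i]) : Im (z + w) = Im z + Im w.
Proof. by case: z; case: w. Qed.

Lemma conjc0 : conjc (0 : R[i]) = 0.
Proof. exact: rmorph0. Qed.

Lemma Re_conjc (z : R[i]) : Re (conjc z) = Re z.
Proof. by case: z. Qed.

Lemma Im_conjc (z : R[i]) : Im (conjc z) = - Im z.
Proof. by case: z. Qed.

Definition cintegrable f :=
  mu.-integrable Omega (fun x => (Re (f x))%:E) /\
  mu.-integrable Omega (fun x => (Im (f x))%:E).

Lemma cintegralD f g : cintegrable f -> cintegrable g ->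
  cintegral Omega (fun x => f x + g x) = cintegral Omega f + cintegral Omega g.
Proof.
move=> [f1 f2] [g1 g2]; rewrite /cintegral; congr (_ +i* _).
  by under eq_Rintegral do rewrite ReD; rewrite RintegralD.
by under eq_Rintegral do rewrite ImD; rewrite RintegralD.
Qed.

Lemma cintegralZ (c : R[i]) f : cintegrable f ->
  cintegral Omega (fun x => c * f x) = c * cintegral Omega f.
Proof.
move=> [f1 f2]; have Z (r : R) (g : 'rV[R]_d -> R) : mu.-integrable Omega (fun x => (g x)%:E) ->
    mu.-integrable Omega (fun x => (r * g x)%:E).
  by move=> ig; under eq_fun do rewrite EFinM; exact: integrableZl.
rewrite /cintegral; case: c => a b; congr (_ +i* _).
  under eq_Rintegral do rewrite ReM /=.
  by rewrite RintegralB ?RintegralZl//; exact: Z.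
under eq_Rintegral do rewrite ImM /=.
by rewrite RintegralD ?RintegralZl//; exact: Z.
Qed.

Lemma cintegral_conjc f :
  cintegrable f -> cintegral Omega (fun x => conjc (f x)) = conjc (cintegral Omega f).
Proof.
move=> [f1 f2]; rewrite /cintegral /conjc; congr (_ +i* _).
  by under eq_Rintegral do rewrite Re_conjc.
under eq_Rintegral do rewrite Im_conjc -mulN1r.
by rewrite RintegralZl// mulN1r.
Qed.

(** Square integrability is required on [Omega] only: Bessel's inequality is applied to e^(i x.xi),
    which neither vanishes outside [Omega] nor is square integrable over R^d when d >= 1. *)
Definition sqint f := [/\ measurable_fun setT (fun x => Re (f x)),
  measurable_fun setT (fun x => Im (f x)) &
  mu.-integrable Omega (fun x => (Re (f x) ^+ 2 + Im (f x) ^+ 2)%:E)].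

Lemma sqintD f g : sqint f -> sqint g -> sqint (fun x => f x + g x).
Proof.
move=> [f1 f2 f3] [g1 g2 g3]; split.
- by under eq_fun do rewrite ReD; exact: measurable_funD.
- by under eq_fun do rewrite ImD; exact: measurable_funD.
have H : mu.-integrable Omega (fun x => 2%:E * (Re (f x) ^+ 2 + Im (f x) ^+ 2)%:E
    + 2%:E * (Re (g x) ^+ 2 + Im (g x) ^+ 2)%:E)%E.
  by apply: integrableD => //; exact: integrableZl.
apply: le_integrable H => //.
  apply/measurable_EFinP; apply: measurable_funTS.
  under eq_fun do rewrite ReD ImD.
  by apply: measurable_funD; apply: measurable_funX; exact: measurable_funD.
move=> x _; rewrite -!EFinM -EFinD lee_fin ReD ImD.
rewrite ger0_norm ?addr_ge0 ?sqr_ge0// (le_trans _ (ler_norm _))//.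
have := sqr_ge0 (Re (f x) - Re (g x)); have := sqr_ge0 (Im (f x) - Im (g x)).
nra.
Qed.

Lemma sqintZ (c : R[i]) f : sqint f -> sqint (fun x => c * f x).
Proof.
move=> [f1 f2 f3]; split.
- under eq_fun do rewrite ReM.
  by apply: measurable_funB; exact: measurable_funM.
- under eq_fun do rewrite ImM.
  by apply: measurable_funD; exact: measurable_funM.
rewrite (_ : (fun x => _) = fun x => ((Re c ^+ 2 + Im c ^+ 2)%:E * (Re (f x) ^+ 2 + Im (f x) ^+ 2)%:E)%E).
  exact: integrableZl.
apply/funext => x; rewrite -EFinM; congr EFin; rewrite ReM ImM; ring.
Qed.

Lemma cintegrable_sqint f g : sqint f -> sqint g -> cintegrable (fun x => f x * conjc (g x)).
Proof.
move=> [f1 f2 f3] [g1 g2 g3].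
have H : mu.-integrable Omega (fun x => (Re (f x) ^+ 2 + Im (f x) ^+ 2)%:E
    + (Re (g x) ^+ 2 + Im (g x) ^+ 2)%:E)%E by exact: integrableD.
split; apply: le_integrable H => //.
- apply/measurable_EFinP; apply: measurable_funTS.
  under eq_fun do rewrite ReM Re_conjc Im_conjc mulrN opprK.
  by apply: measurable_funD; exact: measurable_funM.
- move=> x _; rewrite -EFinD lee_fin ReM Re_conjc Im_conjc mulrN opprK.
  rewrite [leRHS]ger0_norm ?addr_ge0 ?sqr_ge0// ler_norml.
  have := sqr_ge0 (Re (f x) - Re (g x)); have := sqr_ge0 (Im (f x) - Im (g x)).
  have := sqr_ge0 (Re (f x) + Re (g x)); have := sqr_ge0 (Im (f x) + Im (g x)).
  move=> *; apply/andP; split; nra.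
- apply/measurable_EFinP; apply: measurable_funTS.
  under eq_fun do rewrite ImM Re_conjc Im_conjc mulrN addrC.
  by apply: measurable_funB; exact: measurable_funM.
- move=> x _; rewrite -EFinD lee_fin ImM Re_conjc Im_conjc mulrN addrC.
  rewrite [leRHS]ger0_norm ?addr_ge0 ?sqr_ge0// ler_norml.
  have := sqr_ge0 (Re (f x) - Im (g x)); have := sqr_ge0 (Im (f x) - Re (g x)).
  have := sqr_ge0 (Re (f x) + Im (g x)); have := sqr_ge0 (Im (f x) + Re (g x)).
  move=> *; apply/andP; split; nra.
Qed.

Lemma L2_innerDl f g h : sqint f -> sqint g -> sqint h ->
  L2_inner Omega (fun x => f x + g x) h = L2_inner Omega f h + L2_inner Omega g h.
Proof.
move=> sf sg sh; rewrite /L2_inner -cintegralD; [|exact: cintegrable_sqint..].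
by congr cintegral; apply/funext => x; rewrite mulrDl.
Qed.

Lemma L2_innerZl (c : R[i]) f h : sqint f -> sqint h ->
  L2_inner Omega (fun x => c * f x) h = c * L2_inner Omega f h.
Proof.
move=> sf sh; rewrite /L2_inner -cintegralZ; last exact: cintegrable_sqint.
by congr cintegral; apply/funext => x; rewrite mulrA.
Qed.

Lemma L2_inner_conj f g : sqint f -> sqint g ->
  L2_inner Omega f g = conjc (L2_inner Omega g f).
Proof.
move=> sf sg; rewrite /L2_inner -cintegral_conjc; last exact: cintegrable_sqint.
by congr cintegral; apply/funext => x; rewrite rmorphM/= conjcK mulrC.
Qed.

Lemma Re_L2_inner_self f :
  Re (L2_inner Omega f f) = (\int[mu]_(x in Omega) (Re (f x) ^+ 2 + Im (f x) ^+ 2))%R.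
Proof.
rewrite /L2_inner /cintegral /=; apply: eq_Rintegral => x _.
rewrite ReM Re_conjc Im_conjc; ring.
Qed.

Lemma Re_L2_inner_ge0 f : 0 <= Re (L2_inner Omega f f).
Proof.
rewrite Re_L2_inner_self; apply: Rintegral_ge0 => x _.
by rewrite addr_ge0 ?sqr_ge0.
Qed.

(* Gram-Schmidt residuals: [e_(n+1) = e_n - z_n phi_n] stays orthogonal to the
   first [n+1] vectors and loses exactly [|z_n|^2] of its squared norm. *)
Lemma bessel_L2 (phi : nat -> 'rV[R]_d -> R[i]) (e : 'rV[R]_d -> R[i]) (n : nat) :
  (forall k, sqint (phi k)) ->
  (forall j k, L2_inner Omega (phi j) (phi k) = (j == k)%:R) ->
  sqint e ->
  \sum_(k < n) Normc.normc (L2_inner Omega e (phi k)) ^+ 2 <= Re (L2_inner Omega e e).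
Proof.
move=> sphi ophi se.
pose z k := L2_inner Omega e (phi k).
suff [en [sen enphi enen]] : exists en, [/\ sqint en,
    forall j, L2_inner Omega en (phi j) = if (j < n)%N then 0 else z j &
    Re (L2_inner Omega en en) = Re (L2_inner Omega e e) -
      \sum_(0 <= k < n) Normc.normc (z k) ^+ 2].
  by rewrite -(big_mkord predT (fun k => Normc.normc (z k) ^+ 2)) -subr_ge0 -enen Re_L2_inner_ge0.
elim: n => [|n [en [sen enphi enen]]].
  by exists e; split => //; rewrite big_nil subr0.
have sz : sqint (fun x => - z n * phi n x) by exact: sqintZ.
exists (fun x => en x + - z n * phi n x); split.
- exact: sqintD.
- move=> j; rewrite L2_innerDl// L2_innerZl// ophi enphi ltnS.
  by case: (ltngtP j n) => [jn|jn|->]; rewrite ?mulr0 ?addr0// mulr1 subrr.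
rewrite big_nat_recr// opprD addrA -enen.
have sE := sqintD _ _ sen sz.
(* The new residual is orthogonal to [phi n], since z_n - z_n = 0. So its squared norm equals its
   pairing with the old residual, namely the old squared norm minus |z_n|^2. *)
rewrite L2_innerDl// L2_innerZl// [X in X + _]L2_inner_conj//.
rewrite [X in _ * X]L2_inner_conj// !L2_innerDl// !L2_innerZl//.
rewrite [L2_inner Omega (phi n) en]L2_inner_conj// !ophi enphi ltnn eqxx mulr1 subrr.
rewrite conjc0 mulr0 addr0 Re_conjc ReD mulNr normc_sqr.
by case: (z n) => p q /=; ring.
Qed.

Hypothesis muOmega : (mu Omega < +oo)%E.

Lemma L2_eq0 f x : L2 Omega f -> ~ Omega x -> f x = 0.
Proof. by case=> _ _ _; exact. Qed.

Lemma L2_Re_Im f : L2 Omega f ->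
  measurable_fun setT (fun x => Re (f x)) /\ measurable_fun setT (fun x => Im (f x)).
Proof. by case. Qed.

Lemma measurable_sqr_Re_Im f : L2 Omega f ->
  measurable_fun setT (fun x => Re (f x) ^+ 2 + Im (f x) ^+ 2).
Proof.
by move=> /L2_Re_Im[f1 f2]; apply: measurable_funD; exact: measurable_funX.
Qed.

Lemma L2_lty f : L2 Omega f ->
  (\int[mu]_x (Re (f x) ^+ 2 + Im (f x) ^+ 2)%:E < +oo)%E.
Proof. by case=> _ _; under eq_integral do rewrite normc_sqr. Qed.

Lemma sqint_L2 f : L2 Omega f -> sqint f.
Proof.
move=> fL; have [f1 f2] := L2_Re_Im f fL; split => //.
apply: (integrableS measurableT) => //; apply/integrableP; split.
  by apply/measurable_EFinP; exact: measurable_sqr_Re_Im.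
under eq_integral do rewrite gee0_abs ?lee_fin ?addr_ge0 ?sqr_ge0//.
exact: L2_lty.
Qed.

Let cutoff (g : 'rV[R]_d -> R) : (forall x, ~ Omega x -> g x = 0) ->
  (EFin \o g) \_ Omega = EFin \o g.
Proof.
move=> g0; apply/funext => x; rewrite patchE; case: ifPn => //.
by move/negP; rewrite inE => nx; rewrite /= g0.
Qed.

Lemma cintegral_cutoff f : (forall x, ~ Omega x -> f x = 0) ->
  cintegral setT f = cintegral Omega f.
Proof.
move=> f0; rewrite /cintegral; congr (_ +i* _).
  rewrite [RHS]Rintegral_mkcond; apply: eq_Rintegral => x _; rewrite patchE.
  by case: ifPn => // /negP; rewrite inE => /f0 ->.
rewrite [RHS]Rintegral_mkcond; apply: eq_Rintegral => x _; rewrite patchE.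
by case: ifPn => // /negP; rewrite inE => /f0 ->.
Qed.

(** From |t| <= 1 + t^2, the constant 1 being integrable over a set of finite measure. *)
Lemma integrable_L2 f : L2 Omega f ->
  mu.-integrable setT (EFin \o (fun x => Re (f x))) /\
  mu.-integrable setT (EFin \o (fun x => Im (f x))).
Proof.
move=> fL; have [f1 f2] := L2_Re_Im f fL; have [_ _ f3] := sqint_L2 f fL.
have i1 : mu.-integrable Omega (EFin \o cst (1 : R)).
  apply: measurable_bounded_integrable => //.
  by exists 1; split => // M M1 x _; rewrite /= normr1 ltW.
have i2 : mu.-integrable Omega (fun x => 1 + (Re (f x) ^+ 2 + Im (f x) ^+ 2)%:E)%E.
  exact: integrableD.
have H (g : 'rV[R]_d -> R) : measurable_fun setT g -> (forall x, ~ Omega x -> g x = 0) ->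
    (forall x, g x ^+ 2 <= Re (f x) ^+ 2 + Im (f x) ^+ 2) -> mu.-integrable setT (EFin \o g).
  move=> mg g0 gf; rewrite -(cutoff g g0); apply/(integrable_mkcond _ mOmega).
  apply: le_integrable i2 => //; first by apply/measurable_EFinP; exact: measurable_funTS.
  move=> x _; rewrite -EFinD lee_fin [leRHS]ger0_norm ?addr_ge0 ?sqr_ge0//.
  rewrite ler_norml; have := gf x.
  have := sqr_ge0 (g x - 1); have := sqr_ge0 (g x + 1).
  move=> *; apply/andP; split; nra.
split; apply: H => //.
- by move=> x nx; rewrite (L2_eq0 f x fL nx).
- by move=> x; rewrite lerDl sqr_ge0.
- by move=> x nx; rewrite (L2_eq0 f x fL nx).
- by move=> x; rewrite lerDr sqr_ge0.
Qed.

Lemma fourier_sqr f xi : Normc.normc (fourier f xi) ^+ 2 =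
  (\int[mu]_x (cos (dotv x xi) * Re (f x) + sin (dotv x xi) * Im (f x))) ^+ 2 +
  (\int[mu]_x (cos (dotv x xi) * Im (f x) - sin (dotv x xi) * Re (f x))) ^+ 2.
Proof.
rewrite normc_sqr; congr (_ ^+ 2 + _ ^+ 2).
  by apply: eq_Rintegral => x _; rewrite ReM /= mulNr opprK.
by apply: eq_Rintegral => x _; rewrite ImM /= mulNr.
Qed.

Lemma measurable_fourier_sqr f : L2 Omega f ->
  measurable_fun setT (fun xi => Normc.normc (fourier f xi) ^+ 2).
Proof.
move=> /integrable_L2[i1 i2]; under eq_fun do rewrite fourier_sqr.
exact: (measurable_fourier_norm d _ _ i1 i2).
Qed.

Lemma plancherel f : L2 Omega f ->
  (\int[mu]_xi (Normc.normc (fourier f xi) ^+ 2)%:E =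
   ((2 * pi) ^+ d)%:E * \int[mu]_x (Normc.normc (f x) ^+ 2)%:E)%E.
Proof.
move=> fL; have [i1 i2] := integrable_L2 f fL; have [f1 f2] := L2_Re_Im f fL.
have le2 (g : 'rV[R]_d -> R) : measurable_fun setT g ->
    (forall x, g x ^+ 2 <= Re (f x) ^+ 2 + Im (f x) ^+ 2) -> (\int[mu]_x (g x ^+ 2)%:E < +oo)%E.
  move=> mg gf; apply: le_lt_trans (L2_lty f fL); apply: ge0_le_integral => //.
  - by move=> x _; rewrite lee_fin sqr_ge0.
  - by apply/measurable_EFinP; exact: measurable_funX.
  - by apply/measurable_EFinP; exact: measurable_sqr_Re_Im.
  - by move=> x _; rewrite lee_fin.
under eq_integral do rewrite fourier_sqr.
rewrite (plancherel_re_im d _ _ i1 i2)//; last 2 first.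
- by apply: le2 => // x; rewrite lerDl sqr_ge0.
- by apply: le2 => // x; rewrite lerDr sqr_ge0.
congr (_ * _)%E; rewrite -ge0_integralD//.
- by apply: eq_integral => x _; rewrite normc_sqr.
- by move=> x _; rewrite lee_fin sqr_ge0.
- by apply/measurable_EFinP; exact: measurable_funX.
- by move=> x _; rewrite lee_fin sqr_ge0.
- by apply/measurable_EFinP; exact: measurable_funX.
Qed.

Lemma bessel_fourier (phi : nat -> 'rV[R]_d -> R[i]) n xi :
  (forall k, L2 Omega (phi k)) ->
  (forall j k, L2_inner Omega (phi j) (phi k) = (j == k)%:R) ->
  \sum_(k < n) Normc.normc (fourier (phi k) xi) ^+ 2 <= fine (mu Omega).
Proof.
move=> Lphi ophi.
pose e x : R[i] := cos (dotv x xi) +i* sin (dotv x xi).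
have md : measurable_fun setT (fun x : 'rV[R]_d => dotv x xi).
  apply: measurable_sum => i; apply: measurable_funM => //; exact: measurable_coord.
have e1 x : Re (e x) ^+ 2 + Im (e x) ^+ 2 = 1 by rewrite cos2Dsin2.
have se : sqint e.
  split; [exact: (measurableT_comp measurable_cos)|exact: (measurableT_comp measurable_sin)|].
  under eq_fun do rewrite e1.
  apply: (@measurable_bounded_integrable _ _ _ _ (cst 1)) => //.
  by exists 1; split => // M M1 x _; rewrite /= normr1 ltW.
have sphi k := sqint_L2 _ (Lphi k).
have ee : Re (L2_inner Omega e e) = fine (mu Omega).
  rewrite Re_L2_inner_self; under eq_Rintegral do rewrite e1.
  by rewrite Rintegral_cst// mul1r.
rewrite -ee; apply: le_trans (bessel_L2 phi e n sphi ophi se).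
apply: ler_sum => k _.
(* Bessel's inequality has the exponential in the first slot, hence a conjugate, which leaves the
   modulus unchanged. *)
suff -> : fourier (phi k) xi = conjc (L2_inner Omega e (phi k)).
  by rewrite !normc_sqr Re_conjc Im_conjc sqrrN.
rewrite -L2_inner_conj// /L2_inner /fourier cintegral_cutoff.
  by congr cintegral; apply/funext => x; rewrite mulrC.
by move=> x nx; rewrite (L2_eq0 _ _ (Lphi k) nx) mulr0.
Qed.
End bessel.

(** * Bound on the eigenvalues *)

Section eigenvalue_bound.
Local Open Scope complex_scope.
Context {R : realType} (d : nat).
Local Notation mu := (@lebesgue_rV R d).
Local Notation Re := complex.Re.
Local Notation Im := complex.Im.

Lemma integrable_log_excess (l : R) : (1 <= d)%N ->
  mu.-integrable setT (EFin \o log_excess d l).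
Proof.
move=> d1; apply/integrableP; split.
  by apply/measurable_EFinP; exact: measurable_log_excess.
under eq_integral do rewrite gee0_abs ?lee_fin ?log_excess_ge0//.
apply: le_lt_trans (integral_log_excess d l d1) _.
have B : mu (@unit_ball R d) \is a fin_num by rewrite ge0_fin_numE// unit_ball_ltoo.
by rewrite -(fineK B) -!EFinM ltry.
Qed.

(** The first term is the weight of the star norm and controls high frequencies. The second carries
    the singularity at the origin and is integrable, so it may be paired with the bounded
    |phi_k^|^2. *)
Lemma normr_ln_enorm_le (xi : 'rV[R]_d) :
  `|ln (enorm xi)| <= ln (expR 1 + enorm xi) + log_excess d 0 xi.
Proof.
have x0 := enorm_ge0 d xi.
have e1 : 1 <= expR 1 :> R by rewrite -[leLHS]expR0 ler_expR.
have lnge : 0 <= ln (expR 1 + enorm xi) by rewrite ln_ge0// (le_trans e1)// lerDl.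
rewrite /log_excess sub0r; have [x1|x1] := leP 1 (enorm xi).
  rewrite ger0_norm ?ln_ge0// ler_wpDr ?le_max ?lexx ?orbT//.
  have xp : 0 < enorm xi by rewrite (lt_le_trans _ x1).
  rewrite ler_ln ?posrE ?lerDr ?expR_ge0//.
  by rewrite ltr_pwDl ?expR_gt0.
have lnle : ln (enorm xi) <= 0 by rewrite ln_le0// ltW.
by rewrite ler0_norm// max_l ?oppr_ge0// lerDr.
Qed.

Variable Omega : set 'rV[R]_d.
Hypotheses (mOmega : measurable Omega) (muOmega : (mu Omega < +oo)%E) (d1 : (1 <= d)%N).
Variables (phi : nat -> 'rV[R]_d -> R[i]) (lambda_ : nat -> R).
Hypotheses (Lphi : forall k, L2 Omega (phi k))
  (ophi : forall j k, L2_inner Omega (phi j) (phi k) = (j == k)%:R)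
  (eig : forall k, is_eigenfunction Omega (lambda_ k) (phi k)).

Let q k xi := Normc.normc (fourier (phi k) xi) ^+ 2.

Let q_ge0 k xi : 0 <= q k xi. Proof. exact: sqr_ge0. Qed.

Let mq k : measurable_fun setT (q k).
Proof. exact: (measurable_fourier_sqr d Omega mOmega muOmega). Qed.

Let q_sum n xi : \sum_(k < n) q k xi <= fine (mu Omega).
Proof. exact: (bessel_fourier d Omega mOmega muOmega). Qed.

Let q_le k xi : q k xi <= fine (mu Omega).
Proof.
apply: le_trans (q_sum k.+1 xi); rewrite big_ord_recr/= lerDr.
by apply: sumr_ge0 => i _.
Qed.

Let integral_sqr_phi k : (\int[mu]_x (Normc.normc (phi k x) ^+ 2)%:E = 1)%E.
Proof.
have fin : (\int[mu]_x (Normc.normc (phi k x) ^+ 2)%:E)%E \is a fin_num.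
  rewrite ge0_fin_numE; first by case: (Lphi k).
  by apply: integral_ge0 => x _; rewrite lee_fin sqr_ge0.
rewrite -(fineK fin); congr EFin.
have -> : 1 = Re (L2_inner Omega (phi k) (phi k)) by rewrite ophi eqxx.
rewrite /L2_inner -(cintegral_cutoff d Omega).
  apply: eq_Rintegral => x _; rewrite normc_sqr ReM Re_conjc Im_conjc; ring.
by move=> x nx; rewrite (L2_eq0 _ _ _ _ (Lphi k) nx) mul0r.
Qed.

Let integral_q k : (\int[mu]_xi (q k xi)%:E = ((2 * pi) ^+ d)%:E)%E.
Proof. by rewrite (plancherel d Omega mOmega muOmega)// integral_sqr_phi mule1. Qed.

Let integrable_q k : mu.-integrable setT (EFin \o q k).
Proof.
apply/integrableP; split; first exact/measurable_EFinP.
by under eq_integral do rewrite gee0_abs ?lee_fin//; rewrite integral_q ltry.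
Qed.

Let integrable_excess_q l k : mu.-integrable setT (fun xi => (log_excess d l xi * q k xi)%:E).
Proof.
have H : mu.-integrable setT (fun xi => (fine (mu Omega))%:E * (log_excess d l xi)%:E)%E.
  by apply: integrableZl => //; exact: integrable_log_excess.
apply: le_integrable H => //.
  by apply/measurable_EFinP; apply: measurable_funM => //; exact: measurable_log_excess.
move=> xi _; rewrite lee_fin [leLHS]normrM [leRHS]normrM mulrC ler_wpM2r//.
by rewrite (ger0_norm (q_ge0 k xi)) (le_trans (q_le k xi))// ler_norm.
Qed.

(** This makes the integral in [log_form] a genuine one and allows the integral of l - ln |xi| to be
    split by linearity. *)
Let integrable_ln_q k : mu.-integrable setT (fun xi => (ln (enorm xi) * q k xi)%:E).
Proof.
have [_ /= star _] : form_domain Omega (phi k) by have [] := eig k.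
have i1 : mu.-integrable setT (fun xi => (ln (expR 1 + enorm xi) * q k xi)%:E).
  apply/integrableP; split.
    apply/measurable_EFinP; apply: measurable_funM => //.
    apply: (measurableT_comp (@measurable_ln R)); apply: measurable_funD => //.
    exact: measurable_enorm.
  under eq_integral => xi _.
    rewrite gee0_abs; last first.
      rewrite lee_fin mulr_ge0// ln_ge0// (le_trans (_ : 1 <= expR 1)) ?lerDl ?enorm_ge0//.
      by rewrite -[leLHS]expR0 ler_expR.
    over.
  have sqrte_lty (y : \bar R) : (sqrte y < +oo -> y < +oo)%E.
    by case: y => [r _||]; rewrite ?ltry.
  exact: sqrte_lty star.
have H := integrableD measurableT i1 (integrable_excess_q 0 k).
apply: le_integrable H => //.
  by apply/measurable_EFinP; apply: measurable_funM => //; exact: measurable_ln_enorm.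
move=> xi _; rewrite -EFinD lee_fin -mulrDl [leLHS]normrM [leRHS]normrM ler_wpM2r//.
by rewrite (le_trans (normr_ln_enorm_le xi))// ler_norm.
Qed.

Let eigenvalueE k : lambda_ k = (2 * pi) ^- d * (\int[mu]_xi (ln (enorm xi) * q k xi))%R.
Proof.
have [dom _ /(_ _ dom)] := eig k.
rewrite ophi eqxx mulr1 => /(congr1 (fun z : R[i] => complex.Re z)) /= <-.
rewrite mul0r subr0; congr (_ * _); apply: eq_Rintegral => xi _.
rewrite /q normc_sqr /=; ring.
Qed.

Let cpi : R := (2 * pi) ^- d.

Let cpi_gt0 : 0 < cpi.
Proof. by rewrite invr_gt0 exprn_gt0// mulr_gt0// pi_gt0. Qed.

(** The density (2 pi)^-d |phi_k^|^2 has total mass 1, so l - lambda_k is the average of l - ln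
    |xi|. Moving the positive part under the average is Jensen's inequality. *)
Lemma eigenvalue_excess_le (l : R) k : ((Num.max (l - lambda_ k) 0)%:E <=
  cpi%:E * \int[mu]_xi (log_excess d l xi * q k xi)%:E)%E.
Proof.
have E0 : (0 <= \int[mu]_xi (log_excess d l xi * q k xi)%:E)%E.
  by apply: integral_ge0 => xi _; rewrite lee_fin mulr_ge0// log_excess_ge0.
case: (leP (l - lambda_ k) 0) => _; first by rewrite mule_ge0// lee_fin ltW.
have cq : cpi * (2 * pi) ^+ d = 1.
  by rewrite /cpi mulVf// expf_neq0// mulf_neq0// gt_eqF ?pi_gt0.
have iln := integrable_ln_q k.
have ilq : mu.-integrable setT (fun xi => (l * q k xi)%:E).
  by under eq_fun do rewrite EFinM; apply: integrableZl => //; exact: integrable_q.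
have -> : ((l - lambda_ k)%:E = cpi%:E * \int[mu]_xi ((l * q k xi)%:E - (ln (enorm xi) * q k xi)%:E))%E.
  rewrite (integralB measurableT ilq iln).
  under eq_integral do rewrite EFinM.
  rewrite integralZl//; last exact: integrable_q.
  rewrite integral_q eigenvalueE -[X in (_ * (_ - X))%E]fineK; last exact: integrable_fin_num.
  transitivity (cpi * (l * (2 * pi) ^+ d - (\int[mu]_xi (ln (enorm xi) * q k xi))%R))%:E; last by [].
  by rewrite mulrBr [cpi * (l * _)]mulrCA cq mulr1.
apply: lee_wpmul2l; first by rewrite lee_fin ltW.
apply: le_integral => //; first exact: integrableB.
move=> xi _; rewrite -EFinB lee_fin -mulrBl ler_wpM2r//.
by rewrite /log_excess le_max lexx.
Qed.

(** All terms are nonnegative, so sum and integral may be exchanged; Bessel's inequality then acts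
    at each frequency separately. *)
Lemma sum_excess_le_integral (l : R) :
  (\sum_(0 <= k <oo) (Num.max (l - lambda_ k) 0)%:E <=
   cpi%:E * (mu Omega * \int[mu]_xi (log_excess d l xi)%:E))%E.
Proof.
have E0 k xi : (0 <= (log_excess d l xi * q k xi)%:E)%E.
  by rewrite lee_fin mulr_ge0// log_excess_ge0.
have mE k : measurable_fun setT (fun xi => (log_excess d l xi * q k xi)%:E).
  by apply/measurable_EFinP; apply: measurable_funM => //; exact: measurable_log_excess.
apply: (@le_trans _ _ (\sum_(0 <= k <oo) (cpi%:E * \int[mu]_xi (log_excess d l xi * q k xi)%:E))%E).
  apply: lee_nneseries => [k _ _|k _]; first by rewrite lee_fin le_max lexx orbT.
  exact: eigenvalue_excess_le.
rewrite nneseriesZl; last by move=> k _; exact: integral_ge0.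
apply: lee_wpmul2l; first by rewrite lee_fin ltW.
rewrite -(integral_nneseries mu measurableT mE (fun k xi _ => E0 k xi)).
have fOmega : mu Omega \is a fin_num by rewrite ge0_fin_numE.
rewrite -(fineK fOmega) -ge0_integralZl//; last 3 first.
- by apply/measurable_EFinP; exact: measurable_log_excess.
- by move=> xi _; rewrite lee_fin log_excess_ge0.
- by rewrite lee_fin fine_ge0.
apply: ge0_le_integral => //.
- by move=> xi _; apply: nneseries_ge0 => k _ _; exact: E0.
- apply: ge0_emeasurable_sum => //.
- by apply: emeasurable_funM => //; apply/measurable_EFinP; exact: measurable_log_excess.
(* The bound by |Omega| holds for every partial sum and passes to the limit of the series. *)
move=> xi _; apply: lime_le; first by apply: is_cvg_nneseries => k _ _; exact: E0.
apply: nearW => n; rewrite big_mkord sumEFin lee_fin -mulr_sumr mulrC.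
by rewrite ler_wpM2r ?log_excess_ge0.
Qed.
End eigenvalue_bound.

Theorem theorem3p1 (R : realType) (d : nat) (d_ge1 : (1 <= d)%N)
    (Omega : set 'rV[R]_d) (Omega_open : open Omega)
    (Omega_nonempty : Omega !=set0)
    (Omega_finite : (lebesgue_rV d Omega < +oo)%E)
    (lambda_ : nat -> R) (hlambda : dirichlet_eigenvalues Omega lambda_)
    (lambda : R) :
  (\sum_(0 <= k <oo) (Num.max (lambda - lambda_ k) 0)%:E <=
   ((2 * pi) ^- d)%:E * lebesgue_rV d Omega * (expR (d%:R * lambda))%:E *
   lebesgue_rV d (@unit_ball R d) * (d%:R^-1)%:E)%E.
Proof.
have [_ _ _ [phi [Lphi ophi _] eig]] := hlambda.
have mOmega := open_measurable_mx Omega_open.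
apply: le_trans (sum_excess_le_integral d Omega mOmega Omega_finite d_ge1 phi lambda_ Lphi ophi eig lambda) _.
rewrite -!muleA lee_wpmul2l//; first by rewrite lee_fin invr_ge0 exprn_ge0// mulr_ge0// pi_ge0.
rewrite lee_wpmul2l// [leRHS]muleA.
exact: integral_log_excess.
Qed.
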